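(* Let $F$ and $G$ be experiments on the (action) state space $\Theta=\{\theta_0,\ldots,\theta_n\}$. The following are equivalent: (i) $F\succeq_{\textup{LB}}G$; (ii) $F$ is more flexible than $G$: for every $\boldsymbol{\delta}^*\in\widehat{\Delta}_n$ and every moral hazard environment $\mathcal{M}$, if $\boldsymbol{\delta}^*$ is implementable under $G$ in $\mathcal{M}$ then it is implementable under $F$ in $\mathcal{M}$; (iii) $F$ is more effective than $G$: $I_F(\boldsymbol{\delta}^*,\mathcal{M})\le I_G(\boldsymbol{\delta}^*,\mathcal{M})$ for every $\boldsymbol{\delta}^*\in\widehat{\Delta}_n$ and every moral hazard environment $\mathcal{M}$.
   Context: $\Theta=\{\theta_0,\ldots,\theta_n\}\subset\mathbb{R}$ is the set of the agent's pure actions. An experiment $F$ specifies, for each $\theta$, an absolutely continuous distribution $F(\cdot\mid\theta)$ with density $f(\cdot\mid\theta)$ of a signal in a compact interval $\mathcal{X}$; likewise $G$ on a compact interval $\mathcal{Y}$ with densities $g(\cdot\mid\theta)$. $\widehat{\Delta}_n=\{\boldsymbol{\delta}\in[0,1]^n:\sum_i\delta_i\le1\}$; $\boldsymbol{\delta}$ is a mixed action putting probability $\delta_i$ on $\theta_i$ ($i\ge1$) and $\delta_0=1-\sum_i\delta_i$ on $\theta_0$, and induces signal distribution $F(\cdot\mid\boldsymbol{\delta})=\sum_{i=0}^n\delta_iF(\cdot\mid\theta_i)$. LB order: with $p_{F,i}(x;\boldsymbol{q})=q_if(x\mid\theta_i)/\sum_jq_jf(x\mid\theta_j)$ and $\boldsymbol{p}_F(\boldsymbol{q})=(p_{F,1},\ldots,p_{F,n})(X;\boldsymbol{q})$,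 $X\sim F(\cdot\mid\boldsymbol{q})$, $F\succeq_{\textup{LB}}G$ means $\mathbb{E}[C(\boldsymbol{b}\cdot\boldsymbol{p}_F(\boldsymbol{q}))]\ge\mathbb{E}[C(\boldsymbol{b}\cdot\boldsymbol{p}_G(\boldsymbol{q}))]$ for all $\boldsymbol{q}\in\widehat{\Delta}_n$, $\boldsymbol{b}\in\mathbb{R}^n$ and convex $C:\mathbb{R}\to\mathbb{R}$. A moral hazard environment is $\mathcal{M}=\{\boldsymbol{u},c,\gamma\}$ with $\boldsymbol{u}=(\underline{u},\overline{u})\in\mathbb{R}^2$, $\underline{u}\le\overline{u}$; $c:\widehat{\Delta}_n\to\mathbb{R}$ convex (agent's cost); $\gamma:[\underline{u},\overline{u}]\to\mathbb{R}$ continuous and convex (principal's disutility of delivering utility to the agent). Let $\mathcal{W}^{\boldsymbol{u}}_F$ be the set of Borel-measurable $\hat{w}:\mathcal{X}\to[\underline{u},\overline{u}]$. Define $I_F(\boldsymbol{\delta}^*,\mathcal{M})=\inf_{\hat{w}\in\mathcal{W}^{\boldsymbol{u}}_F}\int_{\mathcal{X}}\gamma(\hat{w}(x))\,dF(x\mid\boldsymbol{\delta}^* )$ subject to (IR) $\int_{\mathcal{X}}\hat{w}\,dF(\cdot\mid\boldsymbol{\delta}^* )-c(\boldsymbol{\delta}^* )\ge0$ and (IC) $\boldsymbol{\delta}^*\in\arg\max_{\boldsymbol{\delta}\in\widehat{\Delta}_n}\big[\int_{\mathcal{X}}\hat{w}\,dF(\cdot\mid\boldsymbol{\delta})-c(\boldsymbol{\delta})\big]$.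 The action $\boldsymbol{\delta}^*$ is implementable under $F$ (in $\mathcal{M}$) if some $\hat{w}\in\mathcal{W}^{\boldsymbol{u}}_F$ satisfies (IR) and (IC); $I_F(\boldsymbol{\delta}^*,\mathcal{M})=+\infty$ if not. Everything is defined analogously for $G$. *)

(* Defs.v *)
From HB Require Import structures.
From mathcomp Require Import all_boot all_order all_algebra.
From mathcomp Require Import all_classical all_reals all_analysis.

Set Implicit Arguments.
Unset Strict Implicit.
Unset Printing Implicit Defensive.

Import Order.TTheory GRing.Theory Num.Theory.
Import numFieldNormedType.Exports.
Local Open Scope classical_set_scope.
Local Open Scope ring_scope.

Section Defs.
Variables (R : realType) (n : nat).

(* A (reduced) mixed action  delta in hat(Delta)_n : delta i is the probability
   of theta_{i+1}; the probability of theta_0 is 1 - sum_i delta i. *)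
Definition in_simplex (d : 'I_n -> R) : Prop :=
  (forall i, 0 <= d i <= 1) /\ \sum_(i < n) d i <= 1.

Definition weight (d : 'I_n -> R) (i : 'I_n.+1) : R :=
  match unlift ord0 i with
  | Some j => d j
  | None => 1 - \sum_(j < n) d j
  end.

Definition vcomb (t : R) (d1 d2 : 'I_n -> R) : 'I_n -> R :=
  fun i => t * d1 i + (1 - t) * d2 i.

Definition convex_on_simplex (c : ('I_n -> R) -> R) : Prop :=
  forall d1 d2 t, in_simplex d1 -> in_simplex d2 -> 0 <= t <= 1 ->
    c (vcomb t d1 d2) <= t * c d1 + (1 - t) * c d2.

Definition convex_on_set (A : set R) (f : R -> R) : Prop :=
  forall x y t, A x -> A y -> 0 <= t <= 1 ->
    f (t * x + (1 - t) * y) <= t * f x + (1 - t) * f y.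

(* An experiment: for each action theta_i (i : 'I_n.+1) an absolutely
   continuous distribution of a signal in the compact interval [ex_lo, ex_hi],
   given by a density ex_dens i w.r.t. Lebesgue measure. *)
Record experiment := Experiment {
  ex_lo : R;
  ex_hi : R;
  ex_lohi : ex_lo <= ex_hi;
  ex_dens : 'I_n.+1 -> R -> R;
  ex_dens_ge0 : forall i x, `[ex_lo, ex_hi]%classic x -> 0 <= ex_dens i x;
  ex_dens_meas : forall i, measurable_fun `[ex_lo, ex_hi]%classic (ex_dens i);
  ex_dens_int1 : forall i,
    (\int[lebesgue_measure]_(x in `[ex_lo, ex_hi]%classic) (ex_dens i x)%:E = 1)%E
}.

Definition support (F : experiment) : set R := `[ex_lo F, ex_hi F]%classic.

Definition mixdens (F : experiment) (d : 'I_n -> R) (x : R) : R :=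
  \sum_(i < n.+1) weight d i * ex_dens F i x.

Definition posterior (F : experiment) (q : 'I_n -> R) (j : 'I_n) (x : R) : R :=
  q j * ex_dens F (lift ord0 j) x / mixdens F q x.

Definition LB_value (F : experiment) (q b : 'I_n -> R) (C : R -> R) : \bar R :=
  (\int[lebesgue_measure]_(x in support F)
     (C (\sum_(j < n) b j * posterior F q j x) * mixdens F q x)%:E)%E.

Definition LB_ge (F G : experiment) : Prop :=
  forall (q b : 'I_n -> R) (C : R -> R),
    in_simplex q -> convex_on_set setT C ->
    (LB_value G q b C <= LB_value F q b C)%E.

Record mh_env := MHEnv {
  u_lo : R;
  u_hi : R;
  u_lohi : u_lo <= u_hi;
  cost : ('I_n -> R) -> R;
  cost_convex : convex_on_simplex cost;
  disutil : R -> R;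
  disutil_cont : {within `[u_lo, u_hi]%classic, continuous disutil};
  disutil_convex : convex_on_set `[u_lo, u_hi]%classic disutil
}.

Definition contract (F : experiment) (M : mh_env) (w : R -> R) : Prop :=
  measurable_fun (support F) w /\
  (forall x, support F x -> u_lo M <= w x <= u_hi M).

Definition exp_wage (F : experiment) (w : R -> R) (d : 'I_n -> R) : \bar R :=
  (\int[lebesgue_measure]_(x in support F) (w x * mixdens F d x)%:E)%E.

Definition IR (F : experiment) (M : mh_env) (w : R -> R) (ds : 'I_n -> R) :=
  ((cost M ds)%:E <= exp_wage F w ds)%E.

Definition IC (F : experiment) (M : mh_env) (w : R -> R) (ds : 'I_n -> R) :=
  forall d, in_simplex d ->
    (exp_wage F w d - (cost M d)%:E <= exp_wage F w ds - (cost M ds)%:E)%E.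

Definition feasible (F : experiment) (M : mh_env) (ds : 'I_n -> R) (w : R -> R) :=
  contract F M w /\ IR F M w ds /\ IC F M w ds.

Definition implementable (F : experiment) (ds : 'I_n -> R) (M : mh_env) : Prop :=
  exists w, feasible F M ds w.

(* I_F(delta*, M): infimum of expected disutility over feasible contracts;
   the infimum of the empty set is +oo, matching the paper's convention. *)
Definition implementation_cost (F : experiment) (ds : 'I_n -> R) (M : mh_env)
  : \bar R :=
  ereal_inf [set (\int[lebesgue_measure]_(x in support F)
                    (disutil M (w x) * mixdens F ds x)%:E)%E
            | w in feasible F M ds].

Definition more_flexible (F G : experiment) : Prop :=
  forall (ds : 'I_n -> R) (M : mh_env), in_simplex ds ->
    implementable G ds M -> implementable F ds M.

Definition more_effective (F G : experiment) : Prop :=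
  forall (ds : 'I_n -> R) (M : mh_env), in_simplex ds ->
    (implementation_cost F ds M <= implementation_cost G ds M)%E.

End Defs.

(* Main.v *)
(** Write [f_i] for the densities of [F]; the expected wages induced by a
    contract [w] depend only on its moments [\int w f_i].

    From the LB order to contracts: for an interior [q], [t |-> max_u (t u - g u)]
    is convex, so the LB order compares the support functions of the sets of
    attainable pairs (moments, expected disutility) under [F] and [G].  Hence the
    moments of any [w] for [G] are approximable under [F] at no larger disutility,
    first for interior and then for all [q].  Approximate solutions are upgraded
    to exact ones by choosing near-minimizers of [\int w^2 \sum_i f_i], which
    converge almost everywhere.

    Conversely, with zero disutility and a cost linear in the mixed action,
    flexibility shows that every moment vector of a [0,1]-valued function under
    [G] is, up to adding a nonnegative constant, one under [F]; applied to [phi]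
    and [1 - phi] and combined with convexity, this removes the constant.  Moments
    of indicators then control the hinges [max(0, t - tau)], and convex functions
    are uniformly approximated on intervals by affine functions plus nonnegative
    combinations of hinges. *)
Require Import Defs.
From HB Require Import structures.
From mathcomp Require Import all_boot all_order all_algebra.
From mathcomp Require Import all_classical all_reals all_analysis.
From mathcomp Require Import measurable_realfun ring lra.

Set Implicit Arguments.
Unset Strict Implicit.
Unset Printing Implicit Defensive.

Import Order.TTheory GRing.Theory Num.Theory.
Import numFieldNormedType.Exports.
Local Open Scope classical_set_scope.
Local Open Scope ring_scope.

(** * Almost everywhere convergence from summable weighted increments *)

Section WeightedConvergence.

(** The constant [c], later the value of a weight at a fixed point, factors out of the sum; hence
    [u] is a constant plus an absolutely convergent telescoping series. *)
Lemma cvgn_weighted_telescope (R : realType) (u : nat -> R) (c : R) : 0 < c ->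
  (\sum_(j <oo) (`|u j.+1 - u j| * c)%:E \is a fin_num)%E -> cvgn u.
Proof.
move=> c0 fin.
have cs : cvgn [normed series (telescope u)].
  apply: nondecreasing_is_cvgn; first by apply: nondecreasing_series => i _ _; exact: normr_ge0.
  exists (fine (\sum_(j <oo) (`|u j.+1 - u j| * c)%:E)%E / c) => _ [k _ <-].
  rewrite ler_pdivlMr// -lee_fin fineK// /series/= mulr_suml.
  rewrite -sumEFin; apply: nneseries_lim_ge => i _ _.
  by rewrite lee_fin mulr_ge0// ltW.
rewrite (_ : u = cst (u 0%N) \+ series (telescope u)).
  apply: is_cvgD; [exact: is_cvg_cst|exact: normed_cvg].
by apply/funext => k; rewrite [LHS]eq_sum_telescope.
Qed.

Context d (T : measurableType d) (R : realType).
Variables (mu : {measure set T -> \bar R}) (D : set T) (mD : measurable D).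
Implicit Types (w m : T -> R) (a b : R).

Definition bmeas a b : set (T -> R) :=
  [set w | measurable_fun D w /\ forall x, D x -> a <= w x <= b].

Lemma bmeas_integrable a b w m : mu.-integrable D (EFin \o m) ->
  bmeas a b w -> mu.-integrable D (EFin \o (fun x => w x * m x)).
Proof.
move=> im [mw wab]; apply: (integrableMr mD mw _ im).
exists (`|a| + `|b|); split; first by rewrite num_real.
move=> M Mab x /= Dx; have /andP[ax xb] := wab x Dx.
rewrite ler_norml; have := ler_norm b; have := ler_norm (- a); rewrite normrN.
have := normr_ge0 a; have := normr_ge0 b; lra.
Qed.

(** The sum of the weighted increments has finite integral, hence is finite almost everywhere; where
    [m] is positive this forces convergence by telescoping. *)
Lemma ae_cvg_summable m (w_ : nat -> T -> R) a b (e : nat -> R) :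
  a <= b -> mu.-integrable D (EFin \o m) -> (forall x, D x -> 0 <= m x) ->
  (forall j, bmeas a b (w_ j)) ->
  (forall j, \int[mu]_(x in D) (`|w_ j.+1 x - w_ j x| * m x) <= e j) ->
  cvgn (series e) ->
  exists2 w, bmeas a b w &
    {ae mu, forall x, D x -> 0 < m x -> w_ ^~ x @ \oo --> w x}.
Proof.
move=> ab im m0 wab we ce.
have ubw x : D x -> has_ubound (range (w_ ^~ x)).
  by move=> Dx; exists b => _ [j _ <-]; have [_ /(_ x Dx)/andP[]] := wab j.
have lbw x : D x -> has_lbound (range (w_ ^~ x)).
  by move=> Dx; exists a => _ [j _ <-]; have [_ /(_ x Dx)/andP[]] := wab j.
(* Clamping makes the bounds immediate and changes nothing where the sequence converges, its limit
   being in [[a, b]]. *)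
exists (fun x => Num.max a (Num.min b (limn_sup (w_ ^~ x)))).
  split.
    apply: measurable_maxr => //.
    apply: measurable_minr => //; apply: measurable_fun_limn_sup => //.
    by move=> j; have [] := wab j.
  move=> x Dx; rewrite le_max lexx /= ge_max ab ge_min lexx //.
have bd j : bmeas 0 (b - a) (fun x => `|w_ j.+1 x - w_ j x|).
  have [m1 w1] := wab j.+1; have [m2 w2] := wab j.
  split; first by apply: measurableT_comp => //; apply: measurable_funB.
  move=> x Dx; rewrite normr_ge0 /=.
  have /andP[? ?] := w1 x Dx; have /andP[? ?] := w2 x Dx.
  by rewrite ler_norml; lra.
pose g j x := (`|w_ j.+1 x - w_ j x| * m x)%:E.
have ig j : mu.-integrable D (g j) by exact: bmeas_integrable (bd j).
have g0 j x : D x -> (0 <= g j x)%E.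
  by move=> Dx; rewrite lee_fin mulr_ge0 ?m0.
have mg j : measurable_fun D (g j) by exact: measurable_int (ig j).
have isum : mu.-integrable D (fun x => \sum_(j <oo) g j x)%E.
  apply/integrableP; split.
    by apply: (ge0_emeasurable_sum (P := xpredT)) => // j x Dx _; exact: g0.
  under eq_integral => x xD.
    rewrite gee0_abs; last by apply: nneseries_ge0 => j _ _; exact/g0/set_mem.
    over.
  rewrite integral_nneseries//.
  have ge j : (\int[mu]_(x in D) g j x <= (e j)%:E)%E.
    rewrite -[leLHS]fineK; first by rewrite lee_fin; exact: we.
    exact: integrable_fin_num.
  have e0 j : 0 <= e j.
    by rewrite -lee_fin; apply: le_trans (ge j); apply: integral_ge0 => x; exact: g0.
  apply: (@le_lt_trans _ _ (\sum_(j <oo) (e j)%:E)%E).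
    apply: lee_nneseries => [j _ _|j _]; last exact: ge.
    by apply: integral_ge0 => x; exact: g0.
  have := cvg_seq_bounded ce => /bounded_fun_has_ubound[M uM].
  apply: (@le_lt_trans _ _ M%:E); last by rewrite ltry.
  apply: lime_le; first by apply: is_cvg_nneseries => j _ _; rewrite lee_fin.
  near=> k; rewrite sumEFin lee_fin; apply: uM; exists k => //.
have := integrable_ae mD isum.
apply: filterS => x /= + Dx mx => /(_ Dx) fx.
have cw : cvgn (w_ ^~ x) by exact: cvgn_weighted_telescope fx.
rewrite cvg_limn_supE//; set l := limn _.
have al : a <= l by apply: limr_ge => //; near=> k; have [_ /(_ x Dx)/andP[]] := wab k.
have lb : l <= b by apply: limr_le => //; near=> k; have [_ /(_ x Dx)/andP[]] := wab k.
by rewrite (min_idPr _)// (max_idPr _).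
Unshelve. all: by end_near. Qed.

End WeightedConvergence.

(** * Decreasing sequences of convex sets of bounded functions *)

Section ConvexSets.
Context d (T : measurableType d) (R : realType).
Variables (mu : {measure set T -> \bar R}) (D : set T) (mD : measurable D).
Implicit Types (w m : T -> R) (a b : R).

Lemma bmeas_comb a b w w' (t : R) : 0 <= t <= 1 ->
  bmeas D a b w -> bmeas D a b w' ->
  bmeas D a b (fun x => t * w x + (1 - t) * w' x).
Proof.
move=> /andP[t0 t1] [mw wab] [mw' wab']; split.
  by apply: measurable_funD; apply: measurable_funM.
move=> x Dx; have /andP[? ?] := wab x Dx; have /andP[? ?] := wab' x Dx.
by apply/andP; split; nra.
Qed.

Lemma bmeas_sqr a b w : bmeas D a b w ->
  bmeas D 0 ((`|a| + `|b|) ^+ 2) (fun x => w x ^+ 2).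
Proof.
move=> [mw wab]; split; first exact: measurable_funX.
move=> x Dx; rewrite sqr_ge0 /=; have /andP[ax xb] := wab x Dx.
rewrite -(real_normK (num_real (w x))) lerXn2r ?nnegrE ?addr_ge0//.
rewrite ler_norml; have := ler_norm b; have := ler_norm (- a); rewrite normrN.
by have := normr_ge0 a; have := normr_ge0 b; lra.
Qed.

(* Near-minimizers of [w |-> \int w^2 m] over [K j] form a Cauchy sequence by
   the parallelogram identity. *)
Lemma convex_sets_ae_cvg m (K : nat -> set (T -> R)) a b :
  a <= b -> mu.-integrable D (EFin \o m) -> (forall x, D x -> 0 <= m x) ->
  (forall j, K j `<=` bmeas D a b) ->
  (forall j w w' t, 0 <= t <= 1 -> K j w -> K j w' ->
    K j (fun x => t * w x + (1 - t) * w' x)) ->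
  (forall j k, (j <= k)%N -> K k `<=` K j) ->
  (forall j, K j !=set0) ->
  exists (w_ : nat -> T -> R) w, [/\ forall j, K j (w_ j), bmeas D a b w &
    {ae mu, forall x, D x -> 0 < m x -> w_ ^~ x @ \oo --> w x}].
Proof.
move=> ab im m0 Kab Kconv Kdecr Kne.
pose N w := \int[mu]_(x in D) (w x ^+ 2 * m x).
pose M := \int[mu]_(x in D) m x.
pose B := (`|a| + `|b|) ^+ 2.
have iN w : bmeas D a b w ->
    mu.-integrable D (EFin \o (fun x => w x ^+ 2 * m x)).
  by move=> /bmeas_sqr; exact: bmeas_integrable.
have N0 w : 0 <= N w.
  by apply: Rintegral_ge0 => x Dx; rewrite mulr_ge0 ?sqr_ge0 ?m0.
have NB w : bmeas D a b w -> N w <= B * M.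
  move=> abw; rewrite -RintegralZl//; apply: le_Rintegral => //.
  - exact: iN.
  - have := integrableZl mD B im; apply: eq_integrable => //.
  - move=> x Dx; rewrite ler_wpM2r ?m0//.
    by have [_ /(_ x Dx)/andP[]] := bmeas_sqr abw.
pose I j := inf [set N w | w in K j].
have Ilb j : has_inf [set N w | w in K j].
  split; first by have [w Kw] := Kne j; exists (N w), w.
  by exists 0 => _ [w _ <-].
have Ile j w : K j w -> I j <= N w.
  by move=> Kw; apply: ge_inf; [case: (Ilb j)|exists w].
have Imono j k : (j <= k)%N -> I j <= I k.
  move=> jk; apply: lb_le_inf; first by case: (Ilb k).
  by move=> _ [w Kw <-]; apply: Ile; exact: Kdecr Kw.
have Isup : has_sup (range I).
  split; first by exists (I 0%N), 0%N.
  exists (B * M) => _ [j _ <-]; have [w Kw] := Kne j.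
  by apply: le_trans (Ile _ _ Kw) _; apply: NB; exact: Kab Kw.
pose S := sup (range I).
have IS j : I j <= S by apply: ub_le_sup; [case: Isup|exists j].
(* Minimizing up to [r j ^+ 2] will bound the weighted L1 increments by a multiple of [r j], which
   is summable. *)
pose r j : R := 2^-1 ^+ j.
have r0 j : 0 < r j by rewrite exprn_gt0.
have /choice[k kP] j : exists k, S - r j ^+ 2 < I k.
  have [_ [k _ <-] Sk] := @sup_adherent _ (range I) (r j ^+ 2) (exprn_gt0 _ (r0 j)) Isup.
  by exists k.
(* Summing the [k i] makes [kk] nondecreasing and at least [k]; the extra [j] gives [j <= kk j], so
   that [w_ j] lies in [K j]. *)
pose kk j := (j + \sum_(i < j.+1) k i)%N.
have kk_mono j : (kk j <= kk j.+1)%N.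
  by rewrite /kk [in leqRHS]big_ord_recr /= leq_add// leq_addr.
have IkkS j : S - r j ^+ 2 < I (kk j).
  apply: lt_le_trans (kP j) _; apply: Imono.
  by rewrite /kk big_ord_recr /= addnA leq_addl.
have /choice[w_ w_P] j : exists w, K (kk j) w /\ N w <= S + r j ^+ 2.
  have [_ [w Kw <-] Nw] := inf_adherent (exprn_gt0 2 (r0 j)) (Ilb (kk j)).
  by exists w; split => //; apply: (le_trans (ltW Nw)); rewrite lerD2r IS.
have abw j : bmeas D a b (w_ j) by have [/Kab] := w_P j.
(* The term [M] comes from [r j * m], and [8] from the near-minimality errors of [w_ j], [w_ j.+1]
   and their midpoint. *)
pose e := geometric (M + 8%:R) 2^-1.
have we j : \int[mu]_(x in D) (`|w_ j.+1 x - w_ j x| * m x) <= e j.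
  have [Kj Nj] := w_P j; have [Kj1 Nj1] := w_P j.+1.
  have {}Kj1 := Kdecr _ _ (kk_mono j) _ Kj1.
  have half : 0 <= (2^-1 : R) <= 1 by lra.
  have Kmid := Kconv _ _ _ _ half Kj1 Kj.
  set wm := (fun x => _) in Kmid.
  have abm : bmeas D a b wm by exact: Kab Kmid.
  have Nm : S - r j ^+ 2 <= N wm by apply: le_trans (Ile _ _ Kmid); exact/ltW.
  have Nj1' : N (w_ j.+1) <= S + r j ^+ 2.
    apply: le_trans Nj1 _; rewrite lerD2l lerXn2r ?nnegrE ?(ltW (r0 _))//.
    by rewrite /r exprS ler_piMl ?(ltW (r0 _))//; lra.
  (* The bound [|z| <= r + z^2 / r] stands in for Cauchy-Schwarz; [h] is its right side for
     [z = w_ j.+1 x - w_ j x], times [m x], with the square expanded by the parallelogram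
     identity. *)
  pose h x := r j * m x + ((2 / r j) * (w_ j.+1 x ^+ 2 * m x) +
    ((2 / r j) * (w_ j x ^+ 2 * m x) - (4 / r j) * (wm x ^+ 2 * m x))).
  have i1 : mu.-integrable D (EFin \o (fun x => r j * m x)).
    by have := integrableZl mD (r j) im; apply: eq_integrable.
  have iZ (c : R) w : bmeas D a b w ->
      mu.-integrable D (EFin \o (fun x => c * (w x ^+ 2 * m x))).
    by move=> /iN iw; have := integrableZl mD c iw; apply: eq_integrable.
  have i4 : mu.-integrable D (EFin \o (fun x =>
      (2 / r j) * (w_ j x ^+ 2 * m x) - (4 / r j) * (wm x ^+ 2 * m x))).
    by have := integrableB mD (iZ (2 / r j) _ (abw j)) (iZ (4 / r j) _ abm);
      apply: eq_integrable.
  have i3 : mu.-integrable D (EFin \o (fun x => (2 / r j) * (w_ j.+1 x ^+ 2 * m x) +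
      ((2 / r j) * (w_ j x ^+ 2 * m x) - (4 / r j) * (wm x ^+ 2 * m x)))).
    by have := integrableD mD (iZ (2 / r j) _ (abw j.+1)) i4; apply: eq_integrable.
  have ih : mu.-integrable D (EFin \o h).
    by have := integrableD mD i1 i3; apply: eq_integrable.
  have hE : \int[mu]_(x in D) h x =
      r j * M + ((2 / r j) * N (w_ j.+1) + ((2 / r j) * N (w_ j) - (4 / r j) * N wm)).
    rewrite RintegralD// RintegralZl// RintegralD//; last exact: iZ.
    by rewrite RintegralB//; [rewrite !RintegralZl//; exact: iN|exact: iZ|exact: iZ].
  have rj := r0 j.
  apply: (@le_trans _ _ (\int[mu]_(x in D) h x)).
    apply: le_Rintegral => //.
      apply: (@bmeas_integrable _ _ _ _ _ mD 0 (b - a) _ _ im).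
      have [m1 w1] := abw j.+1; have [m2 w2] := abw j.
      split; first by apply: measurableT_comp => //; apply: measurable_funB.
      move=> x Dx; rewrite normr_ge0 /=.
      have /andP[? ?] := w1 x Dx; have /andP[? ?] := w2 x Dx.
      by rewrite ler_norml; lra.
    move=> x Dx; set u := w_ j.+1 x; set v := w_ j x.
    rewrite (_ : h x = (r j + (u - v) ^+ 2 / r j) * m x); last first.
      by rewrite /h /wm -/u -/v; field; rewrite gt_eqF.
    apply: ler_wpM2r; first exact: m0.
    rewrite -subr_ge0 -(real_normK (num_real (u - v))).
    set z := `|u - v|; have z0 : 0 <= z by exact: normr_ge0.
    rewrite (_ : _ - _ = ((r j - z / 2) ^+ 2 + 3 / 4 * z ^+ 2) / r j); last first.
      by field; rewrite gt_eqF.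
    by rewrite divr_ge0 ?(ltW rj)// addr_ge0 ?sqr_ge0// mulr_ge0 ?sqr_ge0//; lra.
  rewrite hE /e /= -/(r j).
  rewrite -subr_ge0 (_ : _ - _ = ((4 * r j ^+ 2 - 2 * N (w_ j.+1) - 2 * N (w_ j) + 4 * N wm) + 4 * r j ^+ 2) / r j); last first.
    by field; rewrite gt_eqF.
  by rewrite divr_ge0 ?(ltW rj)//; lra.
have ce : cvgn (series e).
  by apply: is_cvg_geometric_series; rewrite ger0_norm; lra.
have [w abw' cw] := ae_cvg_summable mD ab im m0 abw we ce.
exists w_, w; split => // j; have [Kj _] := w_P j.
by apply: Kdecr Kj; rewrite /kk leq_addr.
Qed.

End ConvexSets.

(** * Barycentric weights on the simplex *)

Section Weights.
Variables (R : realType) (n : nat).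
Implicit Types (d q : 'I_n -> R).

Lemma weight0 d : weight d ord0 = 1 - \sum_(j < n) d j.
Proof. by rewrite /weight unlift_none. Qed.

Lemma weight_lift d j : weight d (lift ord0 j) = d j.
Proof. by rewrite /weight liftK. Qed.

Lemma sum_weight d : \sum_(i < n.+1) weight d i = 1.
Proof.
by rewrite big_ord_recl weight0 (eq_bigr d (fun j _ => weight_lift d j)) subrK.
Qed.

Lemma weight_ge0 d i : in_simplex d -> 0 <= weight d i.
Proof.
move=> [d01 sd]; case: (unliftP ord0 i) => [j|] ->.
  by rewrite weight_lift; have /andP[] := d01 j.
by rewrite weight0 subr_ge0.
Qed.

Lemma in_simplexP d : in_simplex d <-> forall i, 0 <= weight d i.
Proof.
split=> [dS i|d0]; first exact: weight_ge0.
have dj j : 0 <= d j by have := d0 (lift ord0 j); rewrite weight_lift.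
have ds : \sum_(j < n) d j <= 1 by have := d0 ord0; rewrite weight0 subr_ge0.
split=> // j; rewrite dj /=; apply: le_trans ds.
by rewrite (bigD1 j)//= lerDl sumr_ge0.
Qed.

Lemma weight_vcomb t d1 d2 i :
  weight (vcomb t d1 d2) i = t * weight d1 i + (1 - t) * weight d2 i.
Proof.
case: (unliftP ord0 i) => [j|] ->; first by rewrite !weight_lift.
rewrite !weight0 big_split/= -!mulr_sumr; ring.
Qed.

(** An interior point, since [theta_0] also gets weight [1/(n+1)]; mixing with it moves any action
    into the interior. *)
Definition uniform_mix : 'I_n -> R := fun=> n.+1%:R^-1.

Lemma weight_uniform i : weight uniform_mix i = n.+1%:R^-1.
Proof.
case: (unliftP ord0 i) => [j|] ->; first by rewrite weight_lift.
rewrite weight0 /uniform_mix sumr_const card_ord -mulr_natl.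
have n1 : (n%:R + 1 : R) != 0 by rewrite natr1 pnatr_eq0.
by rewrite -natr1; field.
Qed.

Lemma uniform_in_simplex : in_simplex uniform_mix.
Proof. by apply/in_simplexP => i; rewrite weight_uniform invr_ge0. Qed.

End Weights.

(** * Moments of bounded functions against the densities *)

Section Moments.
Variables (R : realType) (n : nat) (F : experiment R n).
Local Notation mu := (@lebesgue_measure R).
Local Notation D := (Defs.support F).
Implicit Types (h w : R -> R) (q : 'I_n -> R).

Definition moment h (i : 'I_n.+1) : R :=
  \int[mu]_(x in D) (h x * ex_dens F i x).

Definition mean h q : R := \sum_(i < n.+1) weight q i * moment h i.

Definition bounded_mfun h : Prop := exists M, bmeas D (- M) M h.

(* The sigma-algebra of [lebesgue_measure] and the default one on [R] carry
   different displays. *)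
Lemma support_measurable : measurable (D : set (measurableTypeR R)).
Proof. exact: measurable_itv. Qed.
Let mD := support_measurable.

Lemma dens_integrable i : mu.-integrable D (EFin \o ex_dens F i).
Proof.
apply/integrableP; split; first by apply/measurable_EFinP; exact: ex_dens_meas.
under eq_integral => x /set_mem Dx.
  rewrite gee0_abs; last by rewrite lee_fin; exact: ex_dens_ge0.
  over.
by rewrite ex_dens_int1 ltry.
Qed.

Lemma bmeas_bounded a b h : bmeas D a b h -> bounded_mfun h.
Proof.
move=> [mh hab]; exists (`|a| + `|b|); split => // x Dx.
have /andP[ah hb] := hab x Dx.
have := ler_norm b; have := ler_norm (- a); rewrite normrN.
by have := normr_ge0 a; have := normr_ge0 b; lra.
Qed.

Lemma bounded_cst c : bounded_mfun (cst c).
Proof.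
by apply: (@bmeas_bounded c c); split; [exact: measurable_cst|rewrite /= lexx].
Qed.

Lemma boundedD h1 h2 : bounded_mfun h1 -> bounded_mfun h2 ->
  bounded_mfun (fun x => h1 x + h2 x).
Proof.
move=> [M1 [m1 b1]] [M2 [m2 b2]]; exists (M1 + M2); split.
  exact: measurable_funD.
by move=> x Dx; have := b1 x Dx; have := b2 x Dx; lra.
Qed.

Lemma boundedM h1 h2 : bounded_mfun h1 -> bounded_mfun h2 ->
  bounded_mfun (fun x => h1 x * h2 x).
Proof.
move=> [M1 [m1 b1]] [M2 [m2 b2]]; exists (M1 * M2); split.
  exact: measurable_funM.
move=> x Dx; rewrite -ler_norml normrM ler_pM//.
  by rewrite ler_norml b1.
by rewrite ler_norml b2.
Qed.

Lemma boundedZ c h : bounded_mfun h -> bounded_mfun (fun x => c * h x).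
Proof. exact: boundedM (bounded_cst c). Qed.

Lemma boundedB h1 h2 : bounded_mfun h1 -> bounded_mfun h2 ->
  bounded_mfun (fun x => h1 x - h2 x).
Proof.
move=> b1 b2; have := boundedD b1 (boundedZ (-1) b2).
by under [X in bounded_mfun X -> _]eq_fun do rewrite mulN1r.
Qed.

Lemma moment_integrable h i : bounded_mfun h ->
  mu.-integrable D (EFin \o (fun x => h x * ex_dens F i x)).
Proof. by move=> [M bM]; exact: bmeas_integrable (dens_integrable i) bM. Qed.

Lemma momentD h1 h2 i : bounded_mfun h1 -> bounded_mfun h2 ->
  moment (fun x => h1 x + h2 x) i = moment h1 i + moment h2 i.
Proof.
move=> b1 b2; rewrite -RintegralD//; [|exact: moment_integrable..].
by apply: eq_Rintegral => x _; rewrite mulrDl.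
Qed.

Lemma momentZ c h i : bounded_mfun h ->
  moment (fun x => c * h x) i = c * moment h i.
Proof.
move=> b; rewrite -RintegralZl//; last exact: moment_integrable.
by apply: eq_Rintegral => x _; rewrite mulrA.
Qed.

Lemma momentB h1 h2 i : bounded_mfun h1 -> bounded_mfun h2 ->
  moment (fun x => h1 x - h2 x) i = moment h1 i - moment h2 i.
Proof.
move=> b1 b2; rewrite -RintegralB//; [|exact: moment_integrable..].
by apply: eq_Rintegral => x _; rewrite mulrBl.
Qed.

Lemma moment_cst c i : moment (cst c) i = c.
Proof.
rewrite /moment RintegralZl//; last exact: dens_integrable.
by rewrite /Rintegral ex_dens_int1/= mulr1.
Qed.

Lemma le_moment h1 h2 i : bounded_mfun h1 -> bounded_mfun h2 ->
  (forall x, D x -> h1 x <= h2 x) -> moment h1 i <= moment h2 i.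
Proof.
move=> b1 b2 h12; apply: le_Rintegral => //; [exact: moment_integrable..|].
by move=> x Dx; rewrite ler_wpM2r ?h12//; exact: ex_dens_ge0.
Qed.

Lemma moment_bmeas a b h i : bmeas D a b h -> a <= moment h i <= b.
Proof.
move=> abh; have bh := bmeas_bounded abh; have [_ hab] := abh.
apply/andP; split.
  rewrite -{1}(moment_cst a i); apply: le_moment => //; first exact: bounded_cst.
  by move=> x Dx; have /andP[] := hab x Dx.
rewrite -[leRHS](moment_cst b i); apply: le_moment => //; first exact: bounded_cst.
by move=> x Dx; have /andP[] := hab x Dx.
Qed.

Lemma mean_bmeas a b h q : in_simplex q -> bmeas D a b h -> a <= mean h q <= b.
Proof.
move=> qS abh; rewrite -[a]mulr1 -[b]mulr1 -(sum_weight q) !mulr_sumr.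
apply/andP; split; apply: ler_sum => i _; have /andP[ai ib] := moment_bmeas i abh.
  by rewrite mulrC ler_wpM2l ?weight_ge0.
by rewrite mulrC ler_wpM2r ?weight_ge0.
Qed.

Lemma le_mean h1 h2 q : in_simplex q -> bounded_mfun h1 -> bounded_mfun h2 ->
  (forall x, D x -> h1 x <= h2 x) -> mean h1 q <= mean h2 q.
Proof.
move=> qS b1 b2 h12; apply: ler_sum => i _.
by rewrite ler_wpM2l ?weight_ge0//; exact: le_moment.
Qed.

Lemma mean_vcomb h t q1 q2 :
  mean h (vcomb t q1 q2) = t * mean h q1 + (1 - t) * mean h q2.
Proof.
rewrite /mean !mulr_sumr -big_split/=; apply: eq_bigr => i _.
by rewrite weight_vcomb mulrDl !mulrA.
Qed.

(** The coefficients [a] are arbitrary, because posterior numerators and linear forms on moments are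
    not probability weights. *)
Lemma integral_comb h (a : 'I_n.+1 -> R) : bounded_mfun h ->
  (\int[mu]_(x in D) (h x * \sum_(i < n.+1) a i * ex_dens F i x)%:E =
   (\sum_(i < n.+1) a i * moment h i)%:E)%E.
Proof.
move=> bh.
have iZ i : mu.-integrable D (EFin \o (fun x => a i * (h x * ex_dens F i x))).
  by have := integrableZl mD (a i) (moment_integrable i bh); apply: eq_integrable.
transitivity (\int[mu]_(x in D) (\sum_(i < n.+1) (a i * (h x * ex_dens F i x))%:E)%E)%E.
  apply: eq_integral => x _; rewrite sumEFin mulr_sumr.
  by congr EFin; apply: eq_bigr => i _; rewrite mulrCA.
rewrite integral_sum//.
rewrite -sumEFin; apply: eq_bigr => i _.
rewrite -[LHS]fineK; last exact: (integrable_fin_num mD (iZ i)).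
by congr EFin; rewrite -[LHS]/(Rintegral _ _ _) RintegralZl//; exact: moment_integrable.
Qed.

Lemma integral_mixdens h q : bounded_mfun h ->
  (\int[mu]_(x in D) (h x * mixdens F q x)%:E = (mean h q)%:E)%E.
Proof. exact: integral_comb. Qed.

(** A change of measure: factors pass between the test function and the coefficients, as when a
    posterior absorbs the mixture density. *)
Lemma eq_comb_moments h h' (a a' : 'I_n.+1 -> R) :
  bounded_mfun h -> bounded_mfun h' ->
  (forall x, D x -> h x * (\sum_(i < n.+1) a i * ex_dens F i x) =
    h' x * (\sum_(i < n.+1) a' i * ex_dens F i x)) ->
  \sum_(i < n.+1) a i * moment h i = \sum_(i < n.+1) a' i * moment h' i.
Proof.
move=> bh bh' e; apply: EFin_inj; rewrite -!integral_comb//.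
by apply: eq_integral => x /set_mem Dx; rewrite e.
Qed.

(** Dominated convergence with bound [M] times the density; at points of zero density the integrands
    vanish. *)
Lemma moment_cvg (h_ : nat -> R -> R) h i M :
  (forall j, bmeas D (- M) M (h_ j)) -> bmeas D (- M) M h ->
  {ae mu, forall x, D x -> 0 < ex_dens F i x -> h_ ^~ x @ \oo --> h x} ->
  moment (h_ j) i @[j --> \oo] --> moment h i.
Proof.
move=> bh_ bh aecvg.
have bb_ j : bounded_mfun (h_ j) by exists M.
have bb : bounded_mfun h by exists M.
have [] := @dominated_convergence _ _ _ mu D mD
  (fun j x => (h_ j x * ex_dens F i x)%:E) (fun x => (h x * ex_dens F i x)%:E)
  (fun x => (M * ex_dens F i x)%:E).
- by move=> j; exact: measurable_int (moment_integrable i (bb_ j)).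
- exact: measurable_int (moment_integrable i bb).
- move: aecvg; apply: filterS; first exact: (ae_filter_ringOfSetsType mu).
  move=> x /= + Dx => /(_ Dx) hx; apply: cvg_EFin; first exact: nearW.
  have /= := ex_dens_ge0 i Dx; rewrite le_eqVlt => /predU1P[<-|f0].
    rewrite mulr0; under eq_fun do rewrite mulr0; exact: cvg_cst.
  by apply: cvgMr_tmp; exact: hx.
- have := integrableZl mD M (dens_integrable i); exact: eq_integrable.
- apply: nearW => x j Dx; rewrite lee_fin normrM [X in _ * X]ger0_norm; last exact: ex_dens_ge0.
  rewrite ler_wpM2r//; first exact: ex_dens_ge0.
  by have [_ /(_ x Dx)] := bh_ j; rewrite ler_norml.
move=> _ _ c; apply: fine_cvg; rewrite fineK//.
exact: (integrable_fin_num mD (moment_integrable i bb)).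
Qed.

End Moments.

(** * Approximation from the absence of separating linear forms *)

Section FiniteDimension.
Variables (R : realType) (I : finType).
Implicit Types (s v a : I -> R).

(* Moving from an almost nearest point [s] towards a point [s'] of the set that
   the linear form [v - s] does not separate from [v] decreases the squared
   distance to [v] from [Phi] to at most [(1 - 2 t) Phi + t^2 M]. *)
Lemma unseparated_approx (S : set (I -> R)) v (B : R) :
  S !=set0 -> (forall s i, S s -> `|s i| <= B) ->
  (forall s s' t, 0 <= t <= 1 -> S s -> S s' ->
    S (fun i => t * s i + (1 - t) * s' i)) ->
  (forall a, exists2 s, S s & \sum_i a i * v i <= \sum_i a i * s i) ->
  forall e : R, 0 < e -> exists2 s, S s & forall i, `|s i - v i| <= e.
Proof.
move=> S0 SB Sconv Ssep e e0.
pose Phi s := \sum_i (s i - v i) ^+ 2.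
have Phi0 s : 0 <= Phi s by apply: sumr_ge0 => i _; exact: sqr_ge0.
have infP : has_inf [set Phi s | s in S].
  split; first by have [s Ss] := S0; exists (Phi s), s.
  by exists 0 => _ [s _ <-].
pose d := inf [set Phi s | s in S].
have dle s : S s -> d <= Phi s.
  by move=> Ss; apply: ge_inf; [case: infP|exists s].
suff dlt : d < e ^+ 2.
  have ed : 0 < e ^+ 2 - d by rewrite subr_gt0.
  have [_ [s Ss <-]] := inf_adherent ed infP.
  rewrite -/d subrKC => lte; exists s => // i.
  rewrite -[leRHS]ger0_norm ?(ltW e0)// -ler_sqr ?nnegrE// !real_normK ?num_real//.
  apply: le_trans (ltW lte); rewrite /Phi (bigD1 i)//= lerDl.
  by apply: sumr_ge0 => j _; exact: sqr_ge0.
have [->|/andP[dn0 dge0]] : d = 0 \/ (d != 0) && (0 <= d).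
- have : 0 <= d by apply: lb_le_inf; [case: infP|move=> _ [s _ <-]].
  by have [|] := eqVneq d 0; [left|right].
- exact: exprn_gt0.
have d0 : 0 < d by rewrite lt_neqAle eq_sym dn0.
(* Bounds the squared distance between two points of [S], whose coordinates differ by at most
   [2 * B]; the [1] makes it positive. *)
pose M := \sum_(i : I) (2 * B) ^+ 2 + 1.
have M0 : 0 < M by apply: ltr_wpDl => //; apply: sumr_ge0 => i _; exact: sqr_ge0.
(* With this [t], [t * M < d], hence [(1 - 2 t) (d + t d) + t^2 M < d], which contradicts the
   infimum. *)
pose t := d / (2 * (d + M)).
have tdM : t * (2 * (d + M)) = d by rewrite /t; field; lra.
have t0 : 0 < t by rewrite divr_gt0//; lra.
have t1 : t < 1 by nra.
have [_ [s Ss <-] Phis] := inf_adherent (mulr_gt0 t0 d0) infP.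
have [s' Ss' sep] := Ssep (fun i => v i - s i).
have t01 : 0 <= t <= 1 by rewrite !ltW.
have := dle _ (Sconv s' s t t01 Ss' Ss).
suff : Phi (fun i => t * s' i + (1 - t) * s i) <= (1 - 2 * t) * Phi s + t ^+ 2 * M.
  have t12 : 0 < 1 - 2 * t by nra.
  have h1 : (1 - 2 * t) * Phi s < (1 - 2 * t) * (d + t * d) by rewrite ltr_pM2l.
  have h2 := congr1 (fun z => t / 2 * z) tdM.
  have h3 : 0 < t * d by rewrite mulr_gt0.
  have h4 : 0 < t ^+ 2 * d by rewrite mulr_gt0// exprn_gt0.
  by move: h1 h2 h3 h4 => /=; set P := Phi s; set Q := Phi _; lra.
have dist2 : \sum_i (s' i - s i) ^+ 2 <= M.
  rewrite /M ler_wpDr//; apply: ler_sum => i _.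
  have := SB _ i Ss; have := SB _ i Ss'; rewrite !ler_norml => /andP[? ?] /andP[? ?].
  by nra.
have -> : Phi (fun i => t * s' i + (1 - t) * s i) = (1 - 2 * t) * Phi s +
    t ^+ 2 * (\sum_i (s' i - s i) ^+ 2) +
    2 * t * (\sum_i (v i - s i) * v i - \sum_i (v i - s i) * s' i).
  rewrite /Phi !mulr_sumr -sumrB mulr_sumr -!big_split/=.
  by apply: eq_bigr => i _; ring.
have : t ^+ 2 * (\sum_i (s' i - s i) ^+ 2) <= t ^+ 2 * M by rewrite ler_wpM2l ?sqr_ge0.
have : 2 * t * (\sum_i (v i - s i) * v i - \sum_i (v i - s i) * s' i) <= 0.
  by rewrite mulr_ge0_le0 ?subr_le0//; lra.
by lra.
Qed.

End FiniteDimension.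

(** * From approximate to exact solutions *)

Section Attainment.
Variables (R : realType) (n : nat) (F : experiment R n).
Local Notation mu := (@lebesgue_measure R).
Local Notation D := (Defs.support F).
Implicit Types (h w : R -> R) (q : 'I_n -> R).

Lemma moment_comb t h1 h2 i : bounded_mfun F h1 -> bounded_mfun F h2 ->
  moment F (fun x => t * h1 x + (1 - t) * h2 x) i =
  t * moment F h1 i + (1 - t) * moment F h2 i.
Proof.
by move=> b1 b2; rewrite momentD ?momentZ//; exact: boundedZ.
Qed.

Lemma mean_comb t h1 h2 q : bounded_mfun F h1 -> bounded_mfun F h2 ->
  mean F (fun x => t * h1 x + (1 - t) * h2 x) q =
  t * mean F h1 q + (1 - t) * mean F h2 q.
Proof.
move=> b1 b2; rewrite /mean !mulr_sumr -big_split/=.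
by apply: eq_bigr => i _; rewrite moment_comb//; ring.
Qed.

(** One [M], from the extreme values of [g], serves all [w]: dominated convergence and perturbations
    of [q] need a uniform bound. *)
Lemma bounded_comp a b (g : R -> R) : a <= b ->
  {within `[a, b], continuous g} ->
  exists2 M, 0 <= M & forall w, bmeas D a b w -> bmeas D (- M) M (g \o w).
Proof.
move=> ab cg.
have [c1 c1ab gc1] := EVT_max ab cg; have [c2 c2ab gc2] := EVT_min ab cg.
exists (`|g c1| + `|g c2|); first by rewrite addr_ge0.
move=> w [mw wab]; split.
  apply: (measurable_comp (F := `[a, b])) => //.
    by move=> _ [x Dx <-]; rewrite /= in_itv/= wab.
  exact: subspace_continuous_measurable_fun.
move=> x Dx; have wx : w x \in `[a, b] by rewrite in_itv/= wab.
have := gc1 _ wx; have := gc2 _ wx => /=.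
have := ler_norm (g c1); have := ler_norm (- g c2); rewrite normrN.
by have := normr_ge0 (g c1); have := normr_ge0 (g c2); lra.
Qed.

Lemma convex_comp_mean a b (g : R -> R) t w1 w2 q : a <= b ->
  {within `[a, b], continuous g} -> convex_on_set `[a, b] g -> in_simplex q ->
  0 <= t <= 1 -> bmeas D a b w1 -> bmeas D a b w2 ->
  mean F (g \o (fun x => t * w1 x + (1 - t) * w2 x)) q <=
  t * mean F (g \o w1) q + (1 - t) * mean F (g \o w2) q.
Proof.
move=> ab cg vg qS t01 w1P w2P; have [M M0 gM] := bounded_comp ab cg.
have bg w : bmeas D a b w -> bounded_mfun F (g \o w).
  by move=> /gM; exact: bmeas_bounded.
rewrite -mean_comb//; [|exact: bg..]; apply: le_mean => //.
- exact/bg/bmeas_comb.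
- by apply: boundedD; apply: boundedZ; exact: bg.
move=> x Dx /=; have [_ w1ab] := w1P; have [_ w2ab] := w2P.
by apply: vg => //; rewrite /= in_itv/= ?w1ab ?w2ab.
Qed.

(** The sets of [harmonic j]-approximate solutions are convex, nonempty and decreasing, so members
    of them converge almost everywhere; dominated convergence carries the constraints to the
    limit. *)
Lemma approx_attained a b (g : R -> R) q (v : 'I_n.+1 -> R) (c : R) : a <= b ->
  {within `[a, b], continuous g} -> convex_on_set `[a, b] g -> in_simplex q ->
  (forall e : R, 0 < e -> exists w, [/\ bmeas D a b w,
    forall i, `|moment F w i - v i| <= e & mean F (g \o w) q <= c + e]) ->
  exists w, [/\ bmeas D a b w, moment F w =1 v & mean F (g \o w) q <= c].
Proof.
move=> ab cg vg qS approx; have [M M0 gM] := bounded_comp ab cg.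
(* The sum of all densities is positive wherever one of them is, so a single sequence serves all
   moments. *)
pose m x := \sum_(i < n.+1) ex_dens F i x.
have im : mu.-integrable D (EFin \o m).
  have := integrable_sum (support_measurable F) (index_enum 'I_n.+1)
    (P := xpredT) (fun i _ => dens_integrable F i).
  by apply: eq_integrable => [|x _]; [exact: support_measurable|rewrite /= sumEFin].
have m0 x : D x -> 0 <= m x by move=> Dx; apply: sumr_ge0 => i _; exact: ex_dens_ge0.
pose K j := [set w | [/\ bmeas D a b w,
  forall i, `|moment F w i - v i| <= harmonic j &
  mean F (g \o w) q <= c + harmonic j]].
have Kab j : K j `<=` bmeas D a b by move=> w [].
have Kconv j w w' t : 0 <= t <= 1 -> K j w -> K j w' ->
    K j (fun x => t * w x + (1 - t) * w' x).
  move=> t01 [wab wv wc] [wab' wv' wc']; split; first exact: bmeas_comb.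
    move=> i; rewrite moment_comb; [|exact: bmeas_bounded wab|exact: bmeas_bounded wab'].
    move: (wv i) (wv' i) t01; rewrite !ler_norml => /andP[? ?] /andP[? ?] /andP[? ?].
    by apply/andP; split; nra.
  apply: le_trans (convex_comp_mean ab cg vg qS t01 wab wab') _.
  by have /andP[? ?] := t01; nra.
have Kdecr j k : (j <= k)%N -> K k `<=` K j.
  move=> jk w [wab wv wc].
  have jk' : harmonic k <= harmonic j :> R by rewrite /= lef_pV2 ?posrE// ler_nat.
  split=> //; first by move=> i; exact: le_trans (wv i) jk'.
  by apply: le_trans wc _; rewrite lerD2l.
have Kne j : K j !=set0.
  by have [w [wab wv wc]] := approx (harmonic j) (harmonic_gt0 j); exists w.
have [w_ [w [Kw abw cw]]] := convex_sets_ae_cvg (support_measurable F) ab im m0 Kab Kconv Kdecr Kne.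
have wabj j : bmeas D a b (w_ j) by have [] := Kw j.
have cwi i : {ae mu, forall x, D x -> 0 < ex_dens F i x -> w_ ^~ x @ \oo --> w x}.
  move: cw; apply: filterS.
  move=> x /= + Dx fx; apply => //; apply: lt_le_trans fx _.
  rewrite /m (bigD1 i)//= lerDl sumr_ge0// => k _; exact: ex_dens_ge0.
exists w; split => //.
  move=> i; pose N := `|a| + `|b|.
  have absN h : bmeas D a b h -> bmeas D (- N) N h.
    move=> [mh hab]; split => // x Dx; have /andP[ah hb] := hab x Dx.
    have := ler_norm b; have := ler_norm (- a); rewrite normrN /N.
    by have := normr_ge0 a; have := normr_ge0 b; lra.
  have c1 : moment F (w_ j) i @[j --> \oo] --> moment F w i.
    by apply: (moment_cvg (M := N)) => //; [move=> j|]; exact: absN.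
  have c2 : moment F (w_ j) i @[j --> \oo] --> v i.
    apply: (@squeeze_cvgr _ _ _ _ (fun j => v i - harmonic j) (fun j => v i + harmonic j)).
    - apply: nearW => j; have [_ /(_ i)] := Kw j; rewrite ler_norml; lra.
    - by rewrite -[X in _ --> X]subr0; apply: cvgB; [exact: cvg_cst|exact: cvg_harmonic].
    - by rewrite -[X in _ --> X]addr0; apply: cvgD; [exact: cvg_cst|exact: cvg_harmonic].
  exact: (cvg_unique _ c1 c2).
have c1 : mean F (g \o w_ j) q @[j --> \oo] --> mean F (g \o w) q.
  rewrite /mean; apply: cvg_big => [|i _]; first exact: add_continuous.
  apply: cvgMl_tmp.
  apply: (moment_cvg (M := M)) => //; [by move=> j; exact: gM|exact: gM|].
  move: (cwi i); apply: filterS; first exact: (ae_filter_ringOfSetsType mu).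
  move=> x /= + Dx fx => /(_ Dx fx) cx.
  have inab j : `[a, b]%classic (w_ j x).
    by have [_ /(_ x Dx)] := wabj j; rewrite /= in_itv.
  have wx : `[a, b]%classic (w x) by have [_ /(_ x Dx)] := abw; rewrite /= in_itv.
  have /subspace_continuousP/(_ _ wx) gx := cg.
  move=> P /gx /cx; rewrite /nbhs/= => -[k _ kP]; exists k => // j /kP; apply; exact: inab.
have c2 : (c + harmonic j) @[j --> \oo] --> c.
  by rewrite -[X in _ --> X]addr0; apply: cvgD; [exact: cvg_cst|exact: cvg_harmonic].
by apply: (ler_cvg_to c1 c2); apply: nearW => j; have [] := Kw j.
Qed.

End Attainment.

(** * Posteriors and their linear statistics *)

Section Posterior.
Variables (R : realType) (n : nat) (F : experiment R n).
Local Notation D := (Defs.support F).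
Implicit Types (h w : R -> R) (q b : 'I_n -> R).

Lemma meanB h1 h2 q : bounded_mfun F h1 -> bounded_mfun F h2 ->
  mean F (fun x => h1 x - h2 x) q = mean F h1 q - mean F h2 q.
Proof.
move=> b1 b2; rewrite /mean -sumrB; apply: eq_bigr => i _.
by rewrite momentB// mulrBr.
Qed.

Lemma meanD h1 h2 q : bounded_mfun F h1 -> bounded_mfun F h2 ->
  mean F (fun x => h1 x + h2 x) q = mean F h1 q + mean F h2 q.
Proof.
move=> b1 b2; rewrite /mean -big_split; apply: eq_bigr => i _.
by rewrite momentD// mulrDr.
Qed.

Lemma meanZ c h q : bounded_mfun F h ->
  mean F (fun x => c * h x) q = c * mean F h q.
Proof.
move=> bh; rewrite /mean mulr_sumr; apply: eq_bigr => i _.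
by rewrite momentZ// mulrCA.
Qed.

(** The statistic [b . p_F(q)] whose convex transforms the LB order compares. *)
Definition posterior_form q b (x : R) : R := \sum_(j < n) b j * posterior F q j x.

Lemma weighted_dens_ge0 q i x : in_simplex q -> D x ->
  0 <= weight q i * ex_dens F i x.
Proof. by move=> qS Dx; rewrite mulr_ge0 ?weight_ge0//; exact: ex_dens_ge0. Qed.

(** Where the mixture density vanishes, so does each of its nonnegative terms, so the value [0] of a
    quotient by [0] is consistent. *)
Lemma posterior_mixdens q j x : in_simplex q -> D x ->
  posterior F q j x * mixdens F q x = q j * ex_dens F (lift ord0 j) x.
Proof.
move=> qS Dx; rewrite /posterior.
have [m0|mN0] := eqVneq (mixdens F q x) 0; last by rewrite divfK.
rewrite m0 mulr0; apply/esym/eqP; rewrite -weight_lift.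
move/eqP: m0; rewrite /mixdens psumr_eq0 => [/allP/(_ (lift ord0 j))|i _].
  by rewrite mem_index_enum => /(_ isT).
exact: weighted_dens_ge0.
Qed.

Lemma posterior_bmeas q j : in_simplex q -> bmeas D 0 1 (posterior F q j).
Proof.
move=> qS; have mmix : measurable_fun D (mixdens F q).
  apply: measurable_sum => i; apply: measurable_funM => //.
  exact: ex_dens_meas.
split.
  apply: measurable_funM; first by apply: measurable_funM => //; exact: ex_dens_meas.
  (* The inverse agrees with the measurable real power [-1] on nonnegative reals, both being [0] at
     [0]. *)
  apply: (eq_measurable_fun (fun x => mixdens F q x `^ (-1))).
    move=> x /set_mem Dx; rewrite powR_inv1//.
    by apply: sumr_ge0 => i _; exact: weighted_dens_ge0.
  exact: (measurableT_comp (measurable_powR (-1)) mmix).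
move=> x Dx; rewrite /posterior.
have j0 : 0 <= q j * ex_dens F (lift ord0 j) x.
  by rewrite -weight_lift weighted_dens_ge0.
have jm : q j * ex_dens F (lift ord0 j) x <= mixdens F q x.
  rewrite /mixdens (bigD1 (lift ord0 j))//= weight_lift lerDl.
  by apply: sumr_ge0 => i _; exact: weighted_dens_ge0.
have [m0|mN0] := eqVneq (mixdens F q x) 0; first by rewrite m0 invr0 mulr0 lexx ler01.
have mgt0 : 0 < mixdens F q x by rewrite lt_neqAle eq_sym mN0 (le_trans j0).
by rewrite divr_ge0 ?(ltW mgt0)//= ler_pdivrMr// mul1r.
Qed.

Lemma posterior_form_bmeas q b : in_simplex q ->
  bmeas D (- \sum_(j < n) `|b j|) (\sum_(j < n) `|b j|) (posterior_form q b).
Proof.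
move=> qS; split.
  apply: measurable_sum => j; apply: measurable_funM => //.
  by have [] := posterior_bmeas j qS.
move=> x Dx; rewrite -ler_norml; apply: le_trans (ler_norm_sum _ _ _) _.
apply: ler_sum => j _; rewrite normrM ler_piMr//.
by have [_ /(_ x Dx)/andP[p0 p1]] := posterior_bmeas j qS; rewrite ger0_norm.
Qed.

(** The denominators cancel; the coefficient at [ord0] is [0] because the form does not involve the
    posterior of [theta_0]. *)
Lemma posterior_form_mixdens q b x : in_simplex q -> D x ->
  posterior_form q b x * mixdens F q x =
  \sum_(i < n.+1) oapp (fun j => b j * q j) 0 (unlift ord0 i) * ex_dens F i x.
Proof.
move=> qS Dx; rewrite big_ord_recl unlift_none/= mul0r add0r mulr_suml.
by apply: eq_bigr => j _; rewrite liftK/= -mulrA posterior_mixdens// mulrA.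
Qed.

Lemma LB_valueE q b C : bounded_mfun F (C \o posterior_form q b) ->
  LB_value F q b C = (mean F (C \o posterior_form q b) q)%:E.
Proof. by move=> bC; rewrite -integral_mixdens. Qed.

End Posterior.

(** * From the LB order to moments and disutility *)

Section LBTransfer.
Variables (R : realType) (n : nat) (F G : experiment R n).
Hypothesis FG : LB_ge F G.
Implicit Types (w g : R -> R) (q : 'I_n -> R).

(* Below, [t |-> max_u (t u - g u)] is convex, and any selection of maximizers
   is nondecreasing, hence measurable. *)
Lemma LB_best_response lo hi g q (al : 'I_n.+1 -> R) w : lo <= hi ->
  {within `[lo, hi], continuous g} -> (forall i, 0 < weight q i) ->
  bmeas (Defs.support G) lo hi w ->
  exists2 w', bmeas (Defs.support F) lo hi w' &
    \sum_i al i * moment G w i - mean G (g \o w) q <=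
    \sum_i al i * moment F w' i - mean F (g \o w') q.
Proof.
move=> lohi cg qpos wP.
have qS : in_simplex q by apply/in_simplexP => i; exact: ltW.
have /choice[W WP] t : exists u, lo <= u <= hi /\
    forall u', lo <= u' <= hi -> t * u' - g u' <= t * u - g u.
  have ct : {within `[lo, hi], continuous (fun u => t * u - g u)}.
    move=> u; apply: cvgB; last exact: cg.
    by apply: cvgMl_tmp; apply: (@continuous_subspaceT _ _ _ id) => ?; exact: cvg_id.
  have [u] := EVT_max lohi ct; rewrite in_itv/= => ulh umax.
  by exists u; split => // u' u'lh; apply: umax; rewrite in_itv.
have Wlh t : lo <= W t <= hi by have [] := WP t.
have Wmax t u : lo <= u <= hi -> t * u - g u <= t * W t - g (W t).
  by have [_] := WP t; exact.
(* Adding the optimality inequalities at [s] and [t] gives [(t - s) * (W t - W s) >= 0]. *)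
have Wmono : nondecreasing_fun W.
  move=> s t st; have [->|sNt] := eqVneq s t; first exact: lexx.
  have {sNt}st : s < t by rewrite lt_neqAle sNt.
  have := Wmax s _ (Wlh t); have := Wmax t _ (Wlh s).
  move=> h1 h2; have ts : 0 < t - s by rewrite subr_gt0.
  by rewrite -subr_ge0 -(pmulr_rge0 _ ts); lra.
(* The statistic [S] below is the posterior mean of [r], with the posterior of [theta_0] written as
   one minus the others. Times the mixture density it becomes the combination of densities with
   coefficients [al]. *)
pose r i := al i / weight q i.
pose b j := r (lift ord0 j) - r ord0.
pose C t := (t + r ord0) * W (t + r ord0) - g (W (t + r ord0)).
have Cconv : convex_on_set setT C.
  move=> s t p _ _ /andP[p0 p1]; rewrite /C; set u := W (p * s + _ + _).
  have := Wmax (s + r ord0) _ (Wlh (p * s + (1 - p) * t + r ord0)).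
  have := Wmax (t + r ord0) _ (Wlh (p * s + (1 - p) * t + r ord0)).
  rewrite -/u; move: (W (s + r ord0)) (W (t + r ord0)) u => X Y u.
  have p1' : 0 <= 1 - p by rewrite subr_ge0.
  by move=> /(ler_wpM2l p1') + /(ler_wpM2l p0); lra.
pose S E x := posterior_form E q b x + r ord0.
have SE (E : experiment R n) x : Defs.support E x ->
    S E x * mixdens E q x = \sum_i al i * ex_dens E i x.
  move=> Ex; rewrite mulrDl posterior_form_mixdens// /mixdens mulr_sumr -big_split/=.
  apply: eq_bigr => i _; rewrite mulrA -mulrDl; congr (_ * _).
  have wi : weight q i != 0 by rewrite gt_eqF.
  case: (unliftP ord0 i) wi => [j|] -> wi; last by rewrite /= add0r divfK.
  rewrite /= -(weight_lift q) -mulrDl /b subrK divfK//.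
have bS E : bounded_mfun E (S E).
  by apply: boundedD; [exact/bmeas_bounded/posterior_form_bmeas|exact: bounded_cst].
have Wbm E : bmeas (Defs.support E) lo hi (W \o S E).
  have mW : measurable_fun setT W by exact: nondecreasing_measurable.
  split; last by move=> x _; exact: Wlh.
  by have [M [mS _]] := bS E; exact: measurableT_comp mW mS.
have bg (E : experiment R n) v : bmeas (Defs.support E) lo hi v -> bounded_mfun E (g \o v).
  by have [M _ gM] := bounded_comp E lohi cg => /gM; exact: bmeas_bounded.
have payoff (E : experiment R n) v : bmeas (Defs.support E) lo hi v ->
    mean E (fun x => v x * S E x - g (v x)) q =
    \sum_i al i * moment E v i - mean E (g \o v) q.
  move=> vP; have bv := bmeas_bounded vP.
  rewrite meanB; [|exact: boundedM|exact: bg]; congr (_ - _).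
  apply: eq_comb_moments => //; first exact: boundedM.
  by move=> x Ex; rewrite -mulrA; congr (_ * _); exact: SE.
have bpay (E : experiment R n) v : bmeas (Defs.support E) lo hi v ->
    bounded_mfun E (fun x => v x * S E x - g (v x)).
  move=> vP; apply: boundedB; last exact: bg.
  by apply: boundedM => //; exact: bmeas_bounded vP.
have CE E : C \o posterior_form E q b =
    (fun x => (W \o S E) x * S E x - g ((W \o S E) x)).
  by apply/funext => x; rewrite /C /= [in LHS]mulrC.
(* The best response attains [C] under [F], the LB order compares the means of [C], and under [G]
   the payoff of [w] is pointwise at most [C]. *)
exists (W \o S F) => //; rewrite -!payoff//.
have := FG b qS Cconv; rewrite !LB_valueE ?CE; [|exact: bpay..].
rewrite lee_fin; apply: le_trans; apply: le_mean => //; [exact: bpay..|].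
move=> x Gx; have [_ /(_ x Gx) wx] := wP.
by rewrite mulrC [leRHS](_ : _ = S G x * W (S G x) - g (W (S G x))) ?Wmax// mulrC.
Qed.

(** Moments together with upper bounds on disutility form a bounded convex set under [F]; best
    responses show that no linear form separates it from the point given by [w]. *)
Lemma LB_transfer_approx lo hi g q w : lo <= hi ->
  {within `[lo, hi], continuous g} -> convex_on_set `[lo, hi] g ->
  (forall i, 0 < weight q i) -> bmeas (Defs.support G) lo hi w ->
  forall e : R, 0 < e -> exists w', [/\ bmeas (Defs.support F) lo hi w',
    forall i, `|moment F w' i - moment G w i| <= e &
    mean F (g \o w') q <= mean G (g \o w) q + e].
Proof.
move=> lohi cg vg qpos wP e e0.
have qS : in_simplex q by apply/in_simplexP => i; exact: ltW.
have [MF MF0 gF] := bounded_comp F lohi cg.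
have [MG MG0 gG] := bounded_comp G lohi cg.
pose M := MF + MG.
have meanF v : bmeas (Defs.support F) lo hi v -> - MF <= mean F (g \o v) q <= MF.
  by move=> /gF; exact: mean_bmeas.
have meanG : - MG <= mean G (g \o w) q <= MG by exact: mean_bmeas qS (gG _ wP).
pose mk (m : 'I_n.+1 -> R) (z : R) (k : 'I_n.+2) := oapp m z (unlift ord0 k).
have mk0 m z : mk m z ord0 = z by rewrite /mk unlift_none.
have mkS m z i : mk m z (lift ord0 i) = m i by rewrite /mk liftK.
(* Coordinate [ord0] may exceed the actual disutility, which makes [S] convex; the cap [M] keeps [S]
   bounded. *)
pose S := [set s : 'I_n.+2 -> R | exists2 v, bmeas (Defs.support F) lo hi v &
  (forall i, s (lift ord0 i) = moment F v i) /\ mean F (g \o v) q <= s ord0 <= M].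
have SI v z : bmeas (Defs.support F) lo hi v -> mean F (g \o v) q <= z <= M ->
    S (mk (moment F v) z).
  by move=> vP zP; exists v => //; rewrite mk0.
have FM v : bmeas (Defs.support F) lo hi v -> mean F (g \o v) q <= M.
  by move=> /meanF/andP[_ /le_trans]; apply; rewrite lerDl.
have [s [v vP [sv s0]] se] : exists2 s, S s &
    forall k, `|s k - mk (moment G w) (mean G (g \o w) q) k| <= e.
  apply: (@unseparated_approx _ _ S _ (`|lo| + `|hi| + M)) => //.
  - exists (mk (moment F (cst lo)) (mean F (g \o cst lo) q)).
    have lP : bmeas (Defs.support F) lo hi (cst lo).
      by split; [exact: measurable_cst|rewrite /= lexx lohi].
    by apply: SI => //; rewrite lexx FM.
  - move=> s k [v vP [sv /andP[s0 sM]]]; rewrite ler_norml.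
    have := ler_norm hi; have := ler_norm (- lo); rewrite normrN.
    have := normr_ge0 lo; have := normr_ge0 hi => ? ? ? ?.
    case: (unliftP ord0 k) => [i|] ->.
      by have := moment_bmeas i vP; rewrite sv /M; lra.
    by have := meanF _ vP; move: s0 sM; rewrite /M; lra.
  - move=> s s' t t01 [v vP [sv /andP[s0 sM]]] [v' vP' [sv' /andP[s0' sM']]].
    exists (fun x => t * v x + (1 - t) * v' x); first exact: bmeas_comb.
    split.
      move=> i; rewrite moment_comb ?sv ?sv'//.
        exact: bmeas_bounded vP.
      exact: bmeas_bounded vP'.
    have := convex_comp_mean lohi cg vg qS t01 vP vP'.
    by move: t01 => /andP[? ?] ?; apply/andP; split; nra.
  move=> al.
  (* A nonpositive coefficient rescales the disutility in the best response; for a positive one the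
     cap [M], which exceeds the disutility under [G], is taken and only the moments are
     optimized. *)
  have [al0|al0] := leP (al ord0) 0.
    have cg' : {within `[lo, hi], continuous (fun u => - al ord0 * g u)}.
      by move=> u; apply: cvgMl_tmp; exact: cg.
    have [v vP] := LB_best_response (fun i => al (lift ord0 i)) lohi cg' qpos wP.
    rewrite (meanZ _ _ (bmeas_bounded (gG _ wP))) (meanZ _ _ (bmeas_bounded (gF _ vP))).
    move=> h; exists (mk (moment F v) (mean F (g \o v) q)).
      by apply: SI => //; rewrite lexx FM.
    rewrite big_ord_recl [leRHS]big_ord_recl !mk0.
    under eq_bigr do rewrite mkS; under [in leRHS]eq_bigr do rewrite mkS.
    by lra.
  have [v vP] := LB_best_response (fun i => al (lift ord0 i)) lohi
    (fun u => cvg_cst 0) qpos wP.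
  rewrite (_ : mean G _ q = 0); last first.
    by rewrite /mean big1// => i _; rewrite (moment_cst G 0) mulr0.
  rewrite (_ : mean F _ q = 0); last first.
    by rewrite /mean big1// => i _; rewrite (moment_cst F 0) mulr0.
  rewrite !subr0 => h; exists (mk (moment F v) M).
    by apply: SI => //; rewrite lexx FM.
  rewrite big_ord_recl [leRHS]big_ord_recl !mk0.
  under eq_bigr do rewrite mkS; under [in leRHS]eq_bigr do rewrite mkS.
  apply: lerD => //; rewrite ler_pM2l//; case/andP: meanG => _ /le_trans; apply.
  by rewrite lerDr.
exists v; split => //.
  by move=> i; have := se (lift ord0 i); rewrite sv mkS.
have := se ord0; rewrite mk0 ler_norml; move: s0; lra.
Qed.

Lemma LB_transfer lo hi g q w : lo <= hi ->
  {within `[lo, hi], continuous g} -> convex_on_set `[lo, hi] g ->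
  in_simplex q -> bmeas (Defs.support G) lo hi w ->
  exists w', [/\ bmeas (Defs.support F) lo hi w',
    moment F w' =1 moment G w & mean F (g \o w') q <= mean G (g \o w) q].
Proof.
move=> lohi cg vg qS wP; apply: (approx_attained lohi cg vg qS) => e e0.
have [MF MF0 gF] := bounded_comp F lohi cg.
have [MG MG0 gG] := bounded_comp G lohi cg.
(* Ensures [s < 1] and [2 s (MF + MG) < e / 2]; returning from [q'] to [q] costs at most the latter,
   which leaves [e / 2] for the approximate transfer. *)
pose s := e / (4 * (MF + MG) + e + 1).
have sM : s * (4 * (MF + MG) + e + 1) = e by rewrite /s divfK// gt_eqF//; lra.
have s0 : 0 < s by rewrite divr_gt0//; lra.
have s1 : s < 1 by nra.
pose q' := vcomb (1 - s) q (@uniform_mix R n).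
have q'pos i : 0 < weight q' i.
  rewrite weight_vcomb weight_uniform ltr_wpDl ?mulr_ge0 ?weight_ge0//; first by lra.
  by rewrite subKr divr_gt0.
have [w' [w'P w'm w'g]] := LB_transfer_approx lohi cg vg q'pos wP (divr_gt0 e0 (ltr0Sn R 1)).
exists w'; split => //; first by move=> i; apply: le_trans (w'm i) _; lra.
move: w'g; rewrite !mean_vcomb.
have := mean_bmeas qS (gF _ w'P); have := mean_bmeas (uniform_in_simplex R n) (gF _ w'P).
have := mean_bmeas qS (gG _ wP); have := mean_bmeas (uniform_in_simplex R n) (gG _ wP).
set a1 := mean F _ q; set a2 := mean F _ _.
set b1 := mean G _ q; set b2 := mean G _ _.
move=> /andP[? ?] /andP[? ?] /andP[? ?] /andP[? ?] ab.
have h1 : s * (a1 - b1) <= s * (MF + MG) by rewrite ler_pM2l//; lra.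
have h2 : s * (b2 - a2) <= s * (MF + MG) by rewrite ler_pM2l//; lra.
have h3 : 0 < s * e by rewrite mulr_gt0.
by lra.
Qed.

End LBTransfer.

(** * Implementation, and moments under flexibility *)

Section Implementation.
Variables (R : realType) (n : nat).
Implicit Types (F G : experiment R n) (M : mh_env R n) (d : 'I_n -> R).

(* [Defs.contract F M w] unfolds to [bmeas (Defs.support F) (u_lo M) (u_hi M) w]. *)
Lemma exp_wageE F M w d : Defs.contract F M w -> exp_wage F w d = (mean F w d)%:E.
Proof. by move=> wP; apply: integral_mixdens; exact: bmeas_bounded wP. Qed.

Lemma exp_disutilE F M w d : Defs.contract F M w ->
  (\int[lebesgue_measure]_(x in Defs.support F)
     (disutil M (w x) * mixdens F d x)%:E = (mean F (disutil M \o w) d)%:E)%E.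
Proof.
move=> wP; have [K _ gK] := bounded_comp F (u_lohi M) (@disutil_cont _ _ M).
by rewrite -integral_mixdens//; exact: bmeas_bounded (gK _ wP).
Qed.

(** Both constraints see a contract only through its expected wages, which are linear in its
    moments. *)
Lemma feasible_moments F G M ds w w' : Defs.contract F M w' ->
  moment F w' =1 moment G w -> feasible G M ds w -> feasible F M ds w'.
Proof.
move=> w'P mm [wP [ir ic]]; have e d : exp_wage F w' d = exp_wage G w d.
  rewrite (exp_wageE d w'P) (exp_wageE d wP); congr EFin.
  by apply: eq_bigr => i _; rewrite mm.
by split => //; split; [rewrite /IR e|move=> d dS; rewrite !e; exact: ic].
Qed.

Lemma LB_feasible F G M ds w : LB_ge F G -> in_simplex ds -> feasible G M ds w ->
  exists2 w', feasible F M ds w' &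
    mean F (disutil M \o w') ds <= mean G (disutil M \o w) ds.
Proof.
move=> FG dsS wf; have [wP _] := wf.
have [w' [w'P mm gg]] := LB_transfer FG (u_lohi M) (@disutil_cont _ _ M)
  (@disutil_convex _ _ M) dsS wP.
by exists w' => //; exact: feasible_moments wf.
Qed.

Lemma LB_more_flexible F G : LB_ge F G -> more_flexible F G.
Proof.
by move=> FG ds M dsS [w /(LB_feasible FG dsS)[w' w'f _]]; exists w'.
Qed.

Lemma LB_more_effective F G : LB_ge F G -> more_effective F G.
Proof.
move=> FG ds M dsS; apply: le_ereal_inf_tmp => _ [w wf <-].
have [w' w'f gg] := LB_feasible FG dsS wf.
apply: (@le_trans _ _ (mean F (disutil M \o w') ds)%:E).
  apply: ereal_inf_lbound; exists w' => //; apply: exp_disutilE.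
  by have [] := w'f.
by rewrite exp_disutilE ?lee_fin//; have [] := wf.
Qed.

(** Disutility is bounded along a contract, so every feasible value is finite and [+oo] arises only
    from an empty feasible set. *)
Lemma implementable_cost F M ds : implementable F ds M <->
  (implementation_cost F ds M < +oo)%E.
Proof.
split=> [[w wf]|].
  apply: (@le_lt_trans _ _ (mean F (disutil M \o w) ds)%:E); last by rewrite ltry.
  apply: ereal_inf_lbound; exists w => //; apply: exp_disutilE.
  by have [] := wf.
by rewrite /implementation_cost => /ereal_inf_lt[_ [w wf _] _]; exists w.
Qed.

Lemma more_effective_flexible F G : more_effective F G -> more_flexible F G.
Proof.
move=> FG ds M dsS /implementable_cost GM; apply/implementable_cost.
exact: le_lt_trans (FG ds M dsS) GM.
Qed.

Definition linear_cost (v : 'I_n.+1 -> R) (d : 'I_n -> R) : R :=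
  \sum_(i < n.+1) weight d i * v i.

Lemma linear_cost_convex v : convex_on_simplex (linear_cost v).
Proof.
move=> d1 d2 t _ _ _; rewrite /linear_cost !mulr_sumr -big_split/=.
by apply: ler_sum => i _; rewrite weight_vcomb mulrDl !mulrA.
Qed.

Lemma cst0_cont : {within `[0 : R, 1]%classic, continuous (cst (0 : R))}.
Proof. by move=> x; exact: cvg_cst. Qed.

Lemma cst0_convex : convex_on_set `[0 : R, 1]%classic (cst 0).
Proof. by move=> x y t _ _ _; rewrite /= !mulr0 addr0. Qed.

(** Zero disutility and utilities in [[0, 1]]: implementability alone carries information. *)
Definition linear_env (v : 'I_n.+1 -> R) : mh_env R n :=
  MHEnv ler01 (@linear_cost_convex v) cst0_cont cst0_convex.

(** The pure action [theta_i]; for [ord0] all coordinates are [0]. *)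
Definition vertex (i : 'I_n.+1) : 'I_n -> R := fun j => (lift ord0 j == i)%:R.

Lemma weight_vertex i k : weight (vertex i) k = (k == i)%:R.
Proof.
case: (unliftP ord0 k) => [j|] ->; first by rewrite weight_lift.
rewrite weight0; case: (unliftP ord0 i) => [j|] ->.
  rewrite (bigD1 j)//= /vertex eqxx big1 ?addr0 ?subrr//.
  by move=> l lj; rewrite (inj_eq lift_inj) (negbTE lj).
by rewrite eqxx big1 ?subr0// => l _; rewrite /vertex eq_sym (negbTE (neq_lift _ _)).
Qed.

Lemma vertex_in_simplex i : in_simplex (vertex i).
Proof. by apply/in_simplexP => k; rewrite weight_vertex ler0n. Qed.

Lemma sum_weight_vertex i (v : 'I_n.+1 -> R) :
  \sum_(k < n.+1) weight (vertex i) k * v k = v i.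
Proof.
rewrite (bigD1 i)//= weight_vertex eqxx mul1r big1 ?addr0// => k ki.
by rewrite weight_vertex (negbTE ki) mul0r.
Qed.

(* Under a cost matching the moments of [phi], the agent is indifferent under
   [phi]; implementing an interior action then forces indifference, and (IR)
   makes the common surplus nonnegative. *)
Lemma flexible_shift F G phi : more_flexible F G ->
  bmeas (Defs.support G) 0 1 phi ->
  exists k psi, [/\ 0 <= k, bmeas (Defs.support F) 0 1 psi &
    forall i, moment F psi i = moment G phi i + k].
Proof.
move=> FG phiP; pose M := linear_env (moment G phi).
pose u := @uniform_mix R n; have uS : in_simplex u by exact: uniform_in_simplex.
have Gu : implementable G u M.
  exists phi; split => //; split; first by rewrite /IR (exp_wageE (M := M)).
  by move=> d dS; rewrite !(exp_wageE (M := M))// -!EFinB !subrr.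
have [psi [psiP [ir ic]]] := FG u M uS Gu.
pose k := mean F psi u - linear_cost (moment G phi) u.
have k0 : 0 <= k.
  by move: ir; rewrite /IR (exp_wageE (M := M))// lee_fin -subr_ge0.
have dk i : moment F psi i - moment G phi i <= k.
  have := ic _ (vertex_in_simplex i); rewrite !(exp_wageE (M := M))// -!EFinB lee_fin.
  by rewrite /mean /= /linear_cost !sum_weight_vertex.
exists k, psi; split => // i; apply/eqP; rewrite addrC -subr_eq eq_le dk /=.
(* The surpluses are at most [k] and average to [k] with positive weights, so none can be strictly
   smaller. *)
rewrite leNgt; apply/negP => ik.
have : \sum_(j < n.+1) weight u j * (moment F psi j - moment G phi j) <
    \sum_(j < n.+1) weight u j * k.
  rewrite (bigD1 i)//= [ltRHS](bigD1 i)//=; apply: ltr_leD.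
    by rewrite ltr_pM2l// weight_uniform invr_gt0.
  by apply: ler_sum => j _; rewrite ler_wpM2l// weight_ge0.
rewrite -mulr_suml sum_weight mul1r /k /mean /linear_cost -sumrB.
by under eq_bigr do rewrite mulrBr; rewrite ltxx.
Qed.

(** The shift for [phi] is [k]; the one for [1 - phi], after complementing, gives [- k']. Weight
    [k' / (k + k')] on the first cancels them. *)
Lemma flexible_moments F G phi : more_flexible F G ->
  bmeas (Defs.support G) 0 1 phi ->
  exists2 psi, bmeas (Defs.support F) 0 1 psi & moment F psi =1 moment G phi.
Proof.
move=> FG phiP; have [k [psi [k0 psiP psim]]] := flexible_shift FG phiP.
have compl (E : experiment R n) h : bmeas (Defs.support E) 0 1 h ->
    bmeas (Defs.support E) 0 1 (fun x => (cst 1 x) - h x) /\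
    forall i, moment E (fun x => cst 1 x - h x) i = 1 - moment E h i.
  move=> hP; split.
    have [mh h01] := hP; split; first exact: measurable_funB.
    by move=> x Dx; have /andP[? ?] := h01 x Dx; apply/andP; split => /=; lra.
  move=> i; rewrite momentB ?moment_cst//; [exact: bounded_cst|exact: bmeas_bounded hP].
have [phiP' phim'] := compl _ _ phiP.
have [k' [psi' [k'0 psi'P psim']]] := flexible_shift FG phiP'.
have [psi''P psim''] := compl _ _ psi'P.
have [kk0|kk0] := eqVneq (k + k') 0.
  by exists psi => // i; rewrite psim; lra.
have kkpos : 0 < k + k' by rewrite lt_neqAle eq_sym kk0 addr_ge0.
pose t := k' / (k + k').
have tk : t * (k + k') = k' by rewrite /t divfK.
have t01 : 0 <= t <= 1.
  by rewrite divr_ge0 ?(ltW kkpos)//= ler_pdivrMr// mul1r lerDr.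
exists (fun x => t * psi x + (1 - t) * (cst 1 x - psi' x)); first exact: bmeas_comb.
move=> i; rewrite moment_comb; [|exact: bmeas_bounded psiP|exact: bmeas_bounded psi''P].
by rewrite psim'' psim' phim' psim; lra.
Qed.

End Implementation.

(** * Chords, slopes and measurability of convex functions *)

Section ConvexFunctions.
Variables (R : realType) (C : R -> R).
Hypothesis Cconv : convex_on_set setT C.

(** Multiplying out the denominator [z - x] includes the degenerate case [x = z]. *)
Lemma convex_chord (x y z : R) : x <= y <= z ->
  (z - x) * C y <= (z - y) * C x + (y - x) * C z.
Proof.
move=> /andP[xy yz]; have [xz|xz] := eqVneq x z.
  by subst z; have -> : y = x by [apply: le_anti; rewrite xy yz]; lra.
have {xz}xz : 0 < z - x by rewrite subr_gt0 lt_neqAle xz (le_trans xy).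
pose t := (z - y) / (z - x).
have tE : t * (z - x) = z - y by rewrite divfK// gt_eqF.
have t01 : 0 <= t <= 1.
  by rewrite /t divr_ge0 ?(ltW xz) ?subr_ge0//= ler_pdivrMr// mul1r; lra.
have := Cconv I I t01 (x := x) (y := z).
have -> : t * x + (1 - t) * z = y by lra.
rewrite -(ler_pM2l xz); have -> : (z - x) * (t * C x + (1 - t) * C z) =
  (t * (z - x)) * C x + ((z - x) - t * (z - x)) * C z by ring.
by rewrite tE; have -> : z - x - (z - y) = y - x by ring.
Qed.

(** Slopes of a convex function increase, so the slope over [[B, B + 1]] dominates those to its
    left. *)
Lemma convex_increment_le (B x y : R) : x <= y <= B ->
  C y - C x <= (C (B + 1) - C B) * (y - x).
Proof.
move=> /andP[xy yB].
have h1 : (B + 1 - x) * C y <= (B + 1 - y) * C x + (y - x) * C (B + 1).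
  by apply: convex_chord; lra.
have h2 : (B + 1 - y) * C B <= (B + 1 - B) * C y + (B - y) * C (B + 1).
  by apply: convex_chord; lra.
have B1 : 0 < B + 1 - y by lra.
rewrite -(ler_pM2l B1).
have yx : 0 <= y - x by lra.
by have := ler_wpM2l yx h2; lra.
Qed.

(** Strict sublevel sets of a convex function are intervals. *)
Lemma convex_measurable : measurable_fun setT C.
Proof.
apply: (measurability (@RGenInftyO.G R)) => [|/= _ [_] [r] -> <-].
  exact: RGenInftyO.measurableE.
apply: measurableI => //; apply: is_interval_measurable => x z /=.
rewrite !in_itv/= => Cx Cz y /andP[xy yz].
rewrite in_itv/=; have [xz|xz] := eqVneq x z.
  by have -> : y = x by lra.
have {xz}xz : 0 < z - x by rewrite subr_gt0 lt_neqAle xz (le_trans xy).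
have xyz : x <= y <= z by rewrite xy.
rewrite -(ltr_pM2l xz); apply: le_lt_trans (convex_chord xyz) _.
have h1 : (z - y) * C x <= (z - y) * Num.max (C x) (C z).
  by rewrite ler_wpM2l ?subr_ge0// le_max lexx.
have h2 : (y - x) * C z <= (y - x) * Num.max (C x) (C z).
  by rewrite ler_wpM2l ?subr_ge0// le_max lexx orbT.
have h3 : (z - x) * Num.max (C x) (C z) < (z - x) * r.
  by rewrite ltr_pM2l// gt_max Cx.
by lra.
Qed.

End ConvexFunctions.

(** * Uniform approximation by hinges *)

Section HingeApproximation.
Variables (R : realType) (C : R -> R).
Hypothesis Cconv : convex_on_set setT C.

(** The slope bound at the right end, applied to [C] and to its reflection, controls increments in
    both directions. *)
Lemma convex_lipschitz (B : R) : exists2 L, 0 < L &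
  forall x y, - B <= x <= B -> - B <= y <= B -> `|C x - C y| <= L * `|x - y|.
Proof.
have Cconv' : convex_on_set setT (C \o -%R).
  move=> x y t _ _ t01 /=; rewrite opprD -!mulrN; exact: Cconv.
pose K1 := C (B + 1) - C B; pose K2 := C (- (B + 1)) - C (- B).
exists (`|K1| + `|K2| + 1); first by rewrite ltr_wpDl ?addr_ge0.
suff H x y : - B <= x -> x <= y -> y <= B ->
    `|C x - C y| <= (`|K1| + `|K2| + 1) * `|x - y|.
  move=> x y /andP[x1 x2] /andP[y1 y2]; have [xy|/ltW yx] := leP x y; first exact: H.
  by rewrite distrC (distrC x); exact: H.
move=> xB xy yB.
have h1 : C y - C x <= K1 * (y - x) by apply: (convex_increment_le Cconv); rewrite xy.
have h2 : C x - C y <= K2 * (y - x).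
  have := @convex_increment_le R _ Cconv' B (- y) (- x); rewrite /= !opprK.
  rewrite -/K2 (_ : - x + y = y - x); last by rewrite addrC.
  by apply; lra.
have yx : 0 <= y - x by lra.
have h3 : K1 * (y - x) <= `|K1| * (y - x) by rewrite ler_wpM2r// ler_norm.
have h4 : K2 * (y - x) <= `|K2| * (y - x) by rewrite ler_wpM2r// ler_norm.
have h5 : 0 <= `|K1| * (y - x) by rewrite mulr_ge0.
have h6 : 0 <= `|K2| * (y - x) by rewrite mulr_ge0.
rewrite (distrC x) (ger0_norm yx) ler_norml; lra.
Qed.

(** Each pair in [s] holds the coefficient and the kink of a hinge. *)
Definition hinge_comb (al be : R) (s : seq (R * R)) (t : R) : R :=
  al + be * t + \sum_(p <- s) p.1 * Num.max 0 (t - p.2).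

(* The approximant interpolates [C] linearly on a regular grid, whose nodes are
   added one at a time from left to right. *)
Lemma convex_hinge_approx (B e : R) : 0 < B -> 0 < e ->
  exists al be s, all (fun p : R * R => 0 <= p.1) s /\
    forall t, - B <= t <= B -> `|C t - hinge_comb al be s t| <= e.
Proof.
move=> B0 e0; have [L L0 CL] := convex_lipschitz B.
(* Makes the mesh [h] satisfy [2 * L * h <= e]: on one cell [C] and its chord each move by at most
   [L * h]. *)
pose N := (Num.truncn (4 * L * B / e)).+1.
have N0 : 0 < N%:R :> R by rewrite ltr0n.
have Nlt : 4 * L * B / e < N%:R by rewrite truncnS_gt.
pose h := 2 * B / N%:R.
have h0 : 0 < h by rewrite divr_gt0 ?mulr_gt0.
have hN : h * N%:R = 2 * B by rewrite divfK// gt_eqF.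
have Lh : 2 * L * h <= e.
  rewrite /h mulrA ler_pdivrMr// mulrC [e * _]mulrC -ler_pdivrMr//.
  by apply: le_trans (ltW Nlt); rewrite ler_pM2r ?invr_gt0//; lra.
pose node k : R := - B + k%:R * h.
have nodeS k : node k.+1 = node k + h by rewrite /node -natr1 mulrDl mul1r addrA.
have node_ge k : - B <= node k by rewrite lerDl mulr_ge0 ?(ltW h0).
have node_le k : (k <= N)%N -> node k <= B.
  move=> kN; have : k%:R * h <= N%:R * h by rewrite ler_pM2r// ler_nat.
  by rewrite /node; lra.
pose sl k := (C (node k.+1) - C (node k)) / h.
have slE k : sl k * h = C (node k.+1) - C (node k) by rewrite divfK// gt_eqF.
have sl_mono k : sl k <= sl k.+1.
  rewrite ler_pM2r ?invr_gt0//.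
  have kk : node k <= node k.+1 <= node k.+2 by rewrite !nodeS; lra.
  have := convex_chord Cconv kk; rewrite !nodeS.
  rewrite (_ : node k + h + h - node k = 2 * h); last by ring.
  rewrite (_ : node k + h + h - (node k + h) = h); last by ring.
  rewrite (_ : node k + h - node k = h); last by ring.
  by rewrite -mulrDr -mulrA mulrCA ler_pM2l//; lra.
have interp k t : (k < N)%N -> node k <= t <= node k.+1 ->
    `|C t - (C (node k) + sl k * (t - node k))| <= e.
  move=> kN /andP[kt tk]; apply: le_trans Lh.
  have n1 := node_ge k; have n2 := node_le _ kN; rewrite nodeS in n2 tk.
  have n3 := node_le _ (ltnW kN).
  have c1 : `|C t - C (node k)| <= L * h.
    apply: le_trans (CL _ _ _ _) _; [by lra|by lra|].
    by rewrite ler_pM2l// ger0_norm; lra.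
  have c2 : `|sl k * (t - node k)| <= L * h.
    have : `|sl k * h| <= L * h.
      rewrite slE; apply: le_trans (CL _ _ _ _) _; [by rewrite nodeS; lra|by lra|].
      by rewrite nodeS addrAC subrr add0r ger0_norm// ltW.
    apply: le_trans; rewrite (normrM _ (t - _)) (normrM _ h) ler_wpM2l//.
    by rewrite (ger0_norm (ltW h0)) ger0_norm; lra.
  by move: c1 c2; rewrite !ler_norml; lra.
(* Invariant: past [node k] the approximant follows the chord of the next cell, so it is accurate up
   to [node k.+1]. *)
suff H k : exists al be s, [/\ all (fun p : R * R => 0 <= p.1) s,
    forall t, node k <= t -> hinge_comb al be s t = C (node k) + sl k * (t - node k) &
    (k < N)%N -> forall t, - B <= t <= node k.+1 -> `|C t - hinge_comb al be s t| <= e].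
  have [al [be [s [s0 _ sC]]]] := H N.-1; exists al, be, s; split => // t.
  move=> /andP[Bt tB]; apply: sC => //; rewrite Bt /=.
  by rewrite /node mulrC hN; lra.
elim: k => [|k [al [be [s [s0 sN sC]]]]].
  exists (C (node 0) - sl 0%N * node 0), (sl 0%N), [::]; split => //.
    by move=> t _; rewrite /hinge_comb big_nil; ring.
  move=> N1 t /andP[Bt tn]; rewrite /hinge_comb big_nil.
  rewrite (_ : _ + _ + 0 = C (node 0) + sl 0%N * (t - node 0)); last by ring.
  by apply: interp => //; rewrite tn andbT /node mul0r addr0.
(* The new hinge turns slope [sl k] into [sl k.+1] at [node k.+1]; its coefficient is nonnegative by
   convexity. *)
exists al, be, ((sl k.+1 - sl k, node k.+1) :: s).
have E t : hinge_comb al be ((sl k.+1 - sl k, node k.+1) :: s) t =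
    hinge_comb al be s t + (sl k.+1 - sl k) * Num.max 0 (t - node k.+1).
  by rewrite /hinge_comb big_cons /=; ring.
have R1 t : node k.+1 <= t -> hinge_comb al be ((sl k.+1 - sl k, node k.+1) :: s) t =
    C (node k.+1) + sl k.+1 * (t - node k.+1).
  move=> kt; rewrite E (max_idPr _) ?subr_ge0// sN; last first.
    by apply: le_trans kt; rewrite nodeS lerDl ltW.
  by have := slE k; have := nodeS k; set x := node k.+1 => ->; lra.
split => //=; first by rewrite s0 subr_ge0 sl_mono.
move=> kN t /andP[Bt tn]; have [tk|/ltW kt] := leP t (node k.+1).
  rewrite E (max_idPl _) ?subr_le0// mulr0 addr0.
  by apply: sC; [exact: ltnW|rewrite Bt].
by rewrite R1//; apply: interp => //; rewrite kt.
Qed.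

End HingeApproximation.

(** * From flexibility to the LB order *)

Section FlexibleLB.
Variables (R : realType) (n : nat) (F G : experiment R n).
Hypothesis FG : more_flexible F G.
Implicit Types (q b : 'I_n -> R) (E : experiment R n).

Lemma hinge_bounded E q b (tau : R) : in_simplex q ->
  bounded_mfun E (fun x => Num.max 0 (posterior_form E q b x - tau)).
Proof.
move=> qS; have [mT bT] := posterior_form_bmeas E b qS.
set B := \sum_(j < n) _ in bT.
apply: (@bmeas_bounded _ _ _ 0 (B + `|tau|)); split.
  by apply: measurable_maxr => //; apply: measurable_funB.
move=> x Ex; rewrite le_max lexx /= ge_max.
have /andP[] := bT x Ex; have := normr_ge0 tau; have := ler_norm (- tau).
by rewrite normrN => ? ? ? ?; apply/andP; split; lra.
Qed.

(* The hinge [max(0, t - tau)] is [phi t * (t - tau)] for the indicator [phi]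
   of [t > tau], and dominates [psi * (t - tau)] for every [psi] in [0, 1]. *)
Lemma hinge_le q b (tau : R) : in_simplex q ->
  mean G (fun x => Num.max 0 (posterior_form G q b x - tau)) q <=
  mean F (fun x => Num.max 0 (posterior_form F q b x - tau)) q.
Proof.
move=> qS.
pose phi x : R := \1_(`]tau, +oo[%classic : set R) (posterior_form G q b x).
have phiP : bmeas (Defs.support G) 0 1 phi.
  split; last by move=> x _; rewrite /phi indicE; case: (_ \in _); rewrite lexx ler01.
  apply: measurableT_comp; last by have [] := posterior_form_bmeas G b qS.
  exact: measurable_indic.
have [psi psiP psim] := flexible_moments FG phiP.
(* These coefficients do not depend on the experiment, so the mean of [h] times
   [posterior_form - tau] is one function of the moments of [h], which [phi] and [psi] share. *)
pose A i := oapp (fun j => b j * q j) 0 (unlift ord0 i) - tau * weight q i.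
have TA E x : Defs.support E x -> (posterior_form E q b x - tau) * mixdens E q x =
    \sum_(i < n.+1) A i * ex_dens E i x.
  move=> Ex; rewrite mulrBl posterior_form_mixdens// /mixdens mulr_sumr -sumrB.
  by apply: eq_bigr => i _; rewrite /A mulrBl mulrA.
have bT E : bounded_mfun E (fun x => posterior_form E q b x - tau).
  by apply: boundedB; [exact/bmeas_bounded/posterior_form_bmeas|exact: bounded_cst].
have meanA E h : bmeas (Defs.support E) 0 1 h ->
    mean E (fun x => h x * (posterior_form E q b x - tau)) q =
    \sum_(i < n.+1) A i * moment E h i.
  move=> hP; apply: eq_comb_moments; [|exact: bmeas_bounded hP|].
    by apply: boundedM => //; exact: bmeas_bounded hP.
  by move=> x Ex; rewrite -mulrA; congr (_ * _); exact: TA.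
have -> : mean G (fun x => Num.max 0 (posterior_form G q b x - tau)) q =
    mean G (fun x => phi x * (posterior_form G q b x - tau)) q.
  congr (mean G _ q); apply/funext => x; rewrite /phi indicE mem_setE in_itv/= andbT.
  have [h|h] := ltP; first by rewrite mul1r; apply/max_idPr; rewrite subr_ge0 ltW.
  by rewrite mul0r; apply/max_idPl; rewrite subr_le0.
rewrite meanA//; under eq_bigr do rewrite -psim; rewrite -meanA//.
apply: le_mean => //; [|exact: hinge_bounded|].
  by apply: boundedM => //; exact: bmeas_bounded psiP.
move=> x Fx; have [_ /(_ x Fx)/andP[p0 p1]] := psiP.
have [h|h] := leP 0 (posterior_form F q b x - tau).
  by rewrite ler_piMl.
by rewrite mulr_ge0_le0// ltW.
Qed.

(** Replacing [C] by a hinge combination costs [e / 2] under each experiment; affine parts have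
    equal means, and hinges are ordered with nonnegative coefficients. *)
Lemma flexible_LB : LB_ge F G.
Proof.
move=> q b C qS Cconv; pose B := \sum_(j < n) `|b j| + 1.
have B0 : 0 < B by rewrite ltr_wpDl ?sumr_ge0.
have bT E : bmeas (Defs.support E) (- B) B (posterior_form E q b).
  have [mT T] := posterior_form_bmeas E b qS; split => // x Ex.
  by have := T x Ex; rewrite /B; lra.
have bbT E : bounded_mfun E (posterior_form E q b) by exact: bmeas_bounded (bT E).
have bC E : bounded_mfun E (C \o posterior_form E q b).
  have [L L0 CL] := convex_lipschitz Cconv B; have [mT TB] := bT E.
  exists (`|C 0| + L * B); split.
    by apply: measurableT_comp mT; exact: convex_measurable.
  move=> x Ex /=; have Tx := TB x Ex; set y := posterior_form E q b x in Tx *.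
  have : `|C y - C 0| <= L * B.
    apply: le_trans (CL _ _ Tx _) _; first by lra.
    by rewrite subr0 ler_pM2l// ler_norml.
  by have := ler_norm (C 0); have := ler_norm (- C 0); rewrite normrN !ler_norml; lra.
rewrite !LB_valueE// lee_fin; apply/ler_addgt0Pr => e e0.
have e20 : 0 < e / 2 by lra.
have [al [be [s [s0 sC]]]] := convex_hinge_approx Cconv B0 e20.
pose P E x := hinge_comb al be s (posterior_form E q b x).
have bs E s' : bounded_mfun E
    (fun x => \sum_(p <- s') p.1 * Num.max 0 (posterior_form E q b x - p.2)).
  elim: s' => [|p s' IH].
    by under [X in bounded_mfun _ X]eq_fun do rewrite big_nil; exact: bounded_cst.
  under [X in bounded_mfun _ X]eq_fun do rewrite big_cons.
  by apply: boundedD => //; apply: boundedZ; exact: hinge_bounded.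
have ms E s' : mean E
    (fun x => \sum_(p <- s') p.1 * Num.max 0 (posterior_form E q b x - p.2)) q =
    \sum_(p <- s') p.1 * mean E (fun x => Num.max 0 (posterior_form E q b x - p.2)) q.
  elim: s' => [|p s' IH].
    rewrite big_nil; under eq_fun do rewrite big_nil.
    by rewrite /mean big1// => i _; rewrite (moment_cst E 0) mulr0.
  under eq_fun do rewrite big_cons.
  rewrite big_cons -IH meanD//; last by apply: boundedZ; exact: hinge_bounded.
  by rewrite meanZ//; exact: hinge_bounded.
have blin E : bounded_mfun E (fun x => al + be * posterior_form E q b x).
  by apply: boundedD; [exact: bounded_cst|exact: boundedZ].
have bP E : bounded_mfun E (P E) by apply: boundedD.
(* The expected posterior is the prior, so this mean is the same for all experiments. *)
have mlin E : mean E (fun x => al + be * posterior_form E q b x) q =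
    al + be * \sum_(i < n.+1) oapp (fun j => b j * q j) 0 (unlift ord0 i).
  rewrite (@meanD _ _ E (cst al)) ?meanZ//; [|exact: bounded_cst|exact: boundedZ].
  congr (_ + _ * _).
    by rewrite /mean; under eq_bigr do rewrite moment_cst; rewrite -mulr_suml sum_weight mul1r.
  transitivity (\sum_(i < n.+1) oapp (fun j => b j * q j) 0 (unlift ord0 i) *
      moment E (cst 1) i); last by apply: eq_bigr => i _; rewrite moment_cst mulr1.
  apply: eq_comb_moments => //; first exact: bounded_cst.
  by move=> x Ex; rewrite mul1r; exact: posterior_form_mixdens.
have PFG : mean G (P G) q <= mean F (P F) q.
  rewrite /P /hinge_comb (meanD q (blin G) (bs G s)) (meanD q (blin F) (bs F s)).
  rewrite !mlin lerD2l !ms big_seq [leRHS]big_seq.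
  by apply: ler_sum => p /(allP s0) p0; rewrite ler_wpM2l//; exact: hinge_le.
have close E : `|mean E (C \o posterior_form E q b) q - mean E (P E) q| <= e / 2.
  rewrite -meanB// ler_norml; apply: mean_bmeas => //; split.
    have [M1 [m1 _]] := bC E; have [M2 [m2 _]] := bP E; exact: measurable_funB.
  move=> x Ex; have [_ /(_ x Ex) Tx] := bT E.
  by rewrite -ler_norml; exact: sC.
have := close F; have := close G; rewrite !ler_norml; lra.
Qed.

End FlexibleLB.

Theorem theorem2 (R : realType) (n : nat) (F G : experiment R n) :
  (LB_ge F G <-> more_flexible F G) /\ (LB_ge F G <-> more_effective F G).
Proof.
split; split.
- exact: LB_more_flexible.
- exact: flexible_LB.
- exact: LB_more_effective.
- by move=> /more_effective_flexible; exact: flexible_LB.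
Qed.
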